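(* Assume the $\tau$-periodic system described in the context is exponentially stable, let $y_{ref}\in L^2_{loc}(0,\infty;Y_0)$ and $w_{dist}\in L^2_{loc}(0,\infty;U_{d0})$ be $\tau$-periodic, let $u_{reg}\in L^2(0,\tau;U_0)$ satisfy $\mathcal{P}u_{reg}=y_{ref}-\mathcal{P}_dw_{dist}$ on $[0,\tau]$, and let $u(\cdot)$ be the $\tau$-periodic extension of $u_{reg}$. Then $u(\cdot)$ is of the form $u(\cdot)=\Gamma(\cdot)v(\cdot)$, where $(\Pi(\cdot),\Gamma(\cdot))$ is a periodic mild solution of the periodic regulator equations $$\dot\Pi(t)+\Pi(t)S(t)=A(t)\Pi(t)+B(t)\Gamma(t)+B_d(t)E(t),$$ $$0=C(t)\Pi(t)+D(t)\Gamma(t)+F(t),$$ and $v(t)$ is the state of the exosystem $$\dot v(t)=S(t)v(t),\quad v(0)=v_0\in\mathbb{C}^q,\qquad w_{dist}(t)=E(t)v(t),\qquad y_{ref}(t)=-F(t)v(t)$$ generating the reference and disturbance signals, with the choices $q=1$, $S(\cdot)\equiv0$, $E(\cdot)=w_{dist}(\cdot)$, $F(\cdot)=-y_{ref}(\cdot)$ (and $v_0=1$).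
   Context: Let $\tau>0$, let $X$ be a Banach space (the state space) and let $U_0$, $U_{d0}$, $Y_0$ be Hilbert spaces. Consider the system $$\dot x(t)=A(t)x(t)+B(t)u(t)+B_d(t)w_{dist}(t),\quad x(0)=x_0\in X,\qquad y(t)=C(t)x(t)+D(t)u(t),$$ where $A(\cdot),B(\cdot),B_d(\cdot),C(\cdot),D(\cdot)$ are $\tau$-periodic operator-valued functions with $B\in L^\infty(\mathbb{R},\mathcal{L}(U_0,X))$, $B_d\in L^\infty(\mathbb{R},\mathcal{L}(U_{d0},X))$, $C\in L^\infty(\mathbb{R},\mathcal{L}(X,Y_0))$, $D\in L^\infty(\mathbb{R},\mathcal{L}(U_0,Y_0))$. It is assumed that $A(\cdot)$ determines a strongly continuous evolution family $(U_A(t,s))_{t\ge s}\subset\mathcal{L}(X)$: $U_A(t,t)=I$, $U_A(t,r)U_A(r,s)=U_A(t,s)$ for $t\ge r\ge s$, $(t,s)\mapsto U_A(t,s)x$ is continuous for every $x\in X$, and $U_A(t+\tau,s+\tau)=U_A(t,s)$ by periodicity. The system is exponentially stable if there exist $M,\omega>0$ such that $\|U_A(t,s)\|\le Me^{-\omega(t-s)}$ for all $t\ge s$; in this case $I-U_A(\tau,0)$ is boundedly invertible. Denote $G_A(t,s)=U_A(t,0)(I-U_A(\tau,0))^{-1}U_A(\tau,s)$. The operators $\mathcal{P}\in\mathcal{L}(L^2(0,\tau;U_0),L^2(0,\tau;Y_0))$ and $\mathcal{P}_d\in\mathcal{L}(L^2(0,\tau;U_{d0}),L^2(0,\tau;Y_0))$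 are defined for $t\in[0,\tau]$ by $$(\mathcal{P}u)(t)=C(t)\int_0^\tau G_A(t,s)B(s)u(s)ds+C(t)\int_0^tU_A(t,s)B(s)u(s)ds+D(t)u(t),$$ $$(\mathcal{P}_dw)(t)=C(t)\int_0^\tau G_A(t,s)B_d(s)w(s)ds+C(t)\int_0^tU_A(t,s)B_d(s)w(s)ds.$$ A periodic mild solution of the periodic regulator equations is a pair of $\tau$-periodic functions $\Pi(\cdot)$ (with values in $\mathcal{L}(\mathbb{C}^q,X)$) and $\Gamma(\cdot)$ (with values in $\mathcal{L}(\mathbb{C}^q,U_0)$) such that $$\Pi(t)=U_A(t,0)\Pi(0)U_S(0,t)+\int_0^tU_A(t,s)\big(B(s)\Gamma(s)+B_d(s)E(s)\big)U_S(s,t)\,ds,$$ and $0=C(t)\Pi(t)+D(t)\Gamma(t)+F(t)$ for (almost every) $t\in[0,\tau]$, where $U_S(t,s)$ is the fundamental matrix of $\dot v(t)=S(t)v(t)$. For $q=1$, $\mathcal{L}(\mathbb{C},X)$, $\mathcal{L}(\mathbb{C},U_0)$, $\mathcal{L}(\mathbb{C},U_{d0})$ and $\mathcal{L}(\mathbb{C},Y_0)$ are identified with $X$, $U_0$, $U_{d0}$ and $Y_0$. *)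

(* Defs.v *)
From HB Require Import structures.
From mathcomp Require Import all_boot all_order all_algebra.
From mathcomp Require Import all_classical all_reals all_analysis.
From mathcomp Require Import complex.

Set Implicit Arguments.
Unset Strict Implicit.
Unset Printing Implicit Defensive.

Import Order.TTheory GRing.Theory Num.Theory.
Import numFieldNormedType.Exports.

Local Open Scope classical_set_scope.
Local Open Scope ring_scope.
Local Open Scope complex_scope.

(* Scalars are the complex numbers R[i] over an arbitrary model R of the
   reals, and the time variable ranges over R.  A Banach space is a
   completeNormedModType R[i]; its norm is R[i]-valued and [rnorm] is the same
   norm as an element of R. *)
Definition rnorm (R : realType) (V : normedModType R[i]) (x : V) : R :=
  complex.Re `|x|.

Definition hilbert_space (R : realType) (H : completeNormedModType R[i]) :=
  exists dot : {dot H for Num.conj}, forall x : H, dot x x = `|x| ^+ 2.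

Record bounded_op (K : numFieldType) (V W : normedModType K) := BoundedOp {
  bop_linear :> {linear V -> W};
  bop_continuous : continuous bop_linear }.

(* The identification of L(C, V) with V: the vector x is the operator
   z |-> z x, where C is the space of column vectors of height one. *)
Definition vec_map (K : numFieldType) (V : normedModType K) (x : V)
  (z : 'cV[K]_1) : V := z 0 0 *: x.

Lemma vec_map_linear (K : numFieldType) (V : normedModType K) (x : V) :
  linear (vec_map x).
Proof. by move=> a y z; rewrite /vec_map !mxE scalerDl scalerA. Qed.

HB.instance Definition _ (K : numFieldType) (V : normedModType K) (x : V) :=
  GRing.isLinear.Build K 'cV[K]_1 V _ (vec_map x) (vec_map_linear x).

Lemma vec_map_continuous (K : numFieldType) (V : normedModType K) (x : V) :
  continuous (vec_map x).
Proof.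
move=> z; have h := @coord_continuous K 1 1 0 0 z.
exact: (@cvgZr_tmp K V _ _ (nbhs_filter z) (fun z : 'cV[K]_1 => z 0 0)).
Qed.

Definition op_of_vec (K : numFieldType) (V : normedModType K) (x : V) :
  bounded_op 'cV[K]_1 V := BoundedOp (@vec_map_continuous K V x).

(* Inverse of a bijective map (0 is only a default outside the range). *)
Definition inverse_map (K : numFieldType) (V : normedModType K) (T : V -> V)
  (y : V) : V := xget 0 [set x | T x = y].

Section bochner.
Variable R : realType.

Definition simple_function (T : Type) (s : R -> T) :=
  finite_set (range s) /\
  forall x, measurable (s @^-1` [set x] : set (measurableTypeR R)).

Definition strongly_measurable (V : normedModType R[i]) (D : set R)
    (f : R -> V) :=
  exists2 s : nat -> R -> V, (forall n, simple_function (s n)) &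
    {ae @lebesgue_measure R, forall t, D t -> s n t @[n --> \oo] --> f t}.

(* The spaces L^2(a, b; V) and L^oo(R, L(V, W)) are represented by their
   members, not by classes modulo a.e. equality. *)
Definition L2 (V : normedModType R[i]) (a b : R) (f : R -> V) :=
  strongly_measurable `[a, b] f /\
  (\int[@lebesgue_measure R]_(t in `[a, b]) (rnorm (f t) ^+ 2)%:E < +oo)%E.

Definition L2loc_pos (V : normedModType R[i]) (f : R -> V) :=
  forall a b : R, 0 < a -> a <= b -> L2 a b f.

(* Strong measurability of F as a function into the Banach space L(V, W):
   the approximating simple functions converge in the operator norm. *)
Definition Linfty_op (V W : normedModType R[i]) (F : R -> bounded_op V W) :=
  (exists2 s : nat -> R -> bounded_op V W, (forall n, simple_function (s n)) &
    {ae @lebesgue_measure R, forall t, forall e : R, 0 < e ->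
      \forall n \near \oo,
        forall v, rnorm (s n t v - F t v) <= e * rnorm v}) /\
  exists M : R, {ae @lebesgue_measure R, forall t,
    forall v, rnorm (F t v) <= M * rnorm v}.

Definition simple_integral (V : normedModType R[i]) (a b : R) (s : R -> V) : V :=
  \sum_(x \in range s)
    (fine (@lebesgue_measure R (`[a, b] `&` s @^-1` [set x])))%:C *: x.

Definition is_bochner_integral (V : normedModType R[i]) (a b : R) (f : R -> V)
    (v : V) :=
  strongly_measurable `[a, b] f /\
  exists s : nat -> R -> V,
    [/\ forall n, simple_function (s n),
        (\int[@lebesgue_measure R]_(t in `[a, b]) (rnorm (f t - s n t))%:E)%E
          @[n --> \oo] --> 0%E
      & simple_integral a b (s n) @[n --> \oo] --> v].

Definition bochner_integrable (V : normedModType R[i]) (a b : R)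
    (f : R -> V) := exists v, is_bochner_integral a b f v.

Definition bochner_integral (V : normedModType R[i]) (a b : R)
    (f : R -> V) : V := xget 0 [set v | is_bochner_integral a b f v].

End bochner.

Section periodic_system.
Variables (R : realType) (tau : R).
Local Notation C := R[i].

Definition tau_periodic (T : Type) (f : R -> T) := forall t, f (t + tau) = f t.

(* Periodicity of a signal on the half-line (0, oo). *)
Definition tau_periodic_pos (T : Type) (f : R -> T) :=
  forall t, 0 < t -> f (t + tau) = f t.

(* The tau-periodic function on R that coincides with f on [0, tau). *)
Definition periodic_extension (T : Type) (f : R -> T) (t : R) : T :=
  f (t - tau * (Num.floor (t / tau))%:~R).

(* Only the values U t s with s <= t matter. *)
Definition evolution_family (X : completeNormedModType C)
    (U : R -> R -> bounded_op X X) :=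
  [/\ forall t x, U t t x = x,
      forall t r s x, s <= r -> r <= t -> U t r (U r s x) = U t s x,
      forall x, {within [set p : R * R | p.2 <= p.1],
                   continuous (fun p : R * R => U p.1 p.2 x)}
    & forall t s x, s <= t -> U (t + tau) (s + tau) x = U t s x].

Definition exponentially_stable (X : completeNormedModType C)
    (U : R -> R -> bounded_op X X) :=
  exists M omega : R, [/\ 0 < M, 0 < omega &
    forall t s x, s <= t ->
      rnorm (U t s x) <= M * expR (- omega * (t - s)) * rnorm x].

Definition green (X : completeNormedModType C) (U : R -> R -> bounded_op X X)
    (t s : R) (x : X) : X :=
  U t 0 (inverse_map (fun y => y - U tau 0 y) (U tau s x)).

Definition input_map (X U0 Y0 : completeNormedModType C)
    (U : R -> R -> bounded_op X X) (B : R -> bounded_op U0 X)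
    (Cop : R -> bounded_op X Y0) (D : R -> bounded_op U0 Y0)
    (u : R -> U0) (t : R) : Y0 :=
  Cop t (bochner_integral 0 tau (fun s => green U t s (B s (u s))))
  + Cop t (bochner_integral 0 t (fun s => U t s (B s (u s))))
  + D t (u t).

Definition disturbance_map (X Ud0 Y0 : completeNormedModType C)
    (U : R -> R -> bounded_op X X) (Bd : R -> bounded_op Ud0 X)
    (Cop : R -> bounded_op X Y0) (w : R -> Ud0) (t : R) : Y0 :=
  Cop t (bochner_integral 0 tau (fun s => green U t s (Bd s (w s))))
  + Cop t (bochner_integral 0 t (fun s => U t s (Bd s (w s)))).

Definition has_derivative (V : normedModType C) (f : R -> V) (t : R) (l : V) :=
  (h^-1)%:C *: (f (t + h) - f t) @[h --> (0 : R)^'] --> l.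

Definition fundamental_matrix (q : nat) (S : R -> 'M[C]_q)
    (US : R -> R -> 'M[C]_q) :=
  (forall s, US s s = 1%:M) /\
  forall t s, has_derivative (fun r => US r s) t (S t *m US t s).

Definition exosystem_state (q : nat) (S : R -> 'M[C]_q) (v0 : 'cV[C]_q)
    (v : R -> 'cV[C]_q) :=
  v 0 = v0 /\ forall t, has_derivative v t (S t *m v t).

(* Identities in L(C^q, X), and the integral of the L(C^q, X)-valued integrand,
   are expressed pointwise on C^q; since q is finite, the latter agrees with
   the integral in the operator norm. *)
Definition periodic_mild_solution (X U0 Ud0 Y0 : completeNormedModType C)
    (q : nat) (U : R -> R -> bounded_op X X) (B : R -> bounded_op U0 X)
    (Bd : R -> bounded_op Ud0 X) (Cop : R -> bounded_op X Y0)
    (D : R -> bounded_op U0 Y0) (S : R -> 'M[C]_q)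
    (E : R -> bounded_op 'cV[C]_q Ud0) (F : R -> bounded_op 'cV[C]_q Y0)
    (Pi : R -> bounded_op 'cV[C]_q X) (Gamma : R -> bounded_op 'cV[C]_q U0) :=
  exists2 US : R -> R -> 'M[C]_q, fundamental_matrix S US &
  [/\ tau_periodic Pi, tau_periodic Gamma,
      (forall (t : R) (z : 'cV[C]_q), 0 <= t -> t <= tau ->
        let g s := U t s (B s (Gamma s (US s t *m z))
                          + Bd s (E s (US s t *m z))) in
        bochner_integrable 0 t g /\
        Pi t z = U t 0 (Pi 0 (US 0 t *m z)) + bochner_integral 0 t g)
    & {ae @lebesgue_measure R, forall t, `[0, tau]%classic t ->
        forall z : 'cV[C]_q,
          0 = Cop t (Pi t z) + D t (Gamma t z) + F t z}].

End periodic_system.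

(* Main.v *)
Require Import Defs.
From HB Require Import structures.
From mathcomp Require Import all_boot all_order all_algebra.
From mathcomp Require Import all_classical all_reals all_analysis.
From mathcomp Require Import measurable_realfun complex.
From mathcomp Require Import ring lra.

Set Implicit Arguments.
Unset Strict Implicit.
Unset Printing Implicit Defensive.

Import Order.TTheory GRing.Theory Num.Theory.
Import numFieldNormedType.Exports.
Import HBNNSimple.

Local Open Scope classical_set_scope.
Local Open Scope ring_scope.
Local Open Scope complex_scope.

(** With [q = 1] and [S = 0] the fundamental matrix is
    constantly [1] and the exosystem stays at [v = 1], so [Gamma = u] and the
    whole content of the theorem is the existence of a [tau]-periodic state.
    Put [f s = B s (u s) + Bd s (w_dist s)], [T = U tau 0] and
    [J = int_0^tau U tau s (f s) ds].  Every mild solution satisfies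
    [x t = U t 0 (x 0) + int_0^t U t s (f s) ds], hence it is periodic exactly
    when [x 0 - T (x 0) = J].  Exponential stability makes the powers of [T]
    decay geometrically, so [1 - T] has a bounded inverse given by the Neumann
    series ([neumann_inverse]), and [x 0 = (1 - T)^-1 J] is the right initial
    state.  Pulling the bounded operator [U t 0 (1 - T)^-1] into the integral
    that defines [J] turns [U t 0 (x 0)] into the integral against the Green
    kernel ([green_integral]); so [x] is the state that occurs in the input and
    disturbance maps, and the operator equation assumed for the regulating
    control is, almost everywhere, the equation [0 = C x + D u + F].

    These manipulations need the Bochner integral of Banach space valued
    functions: uniqueness of its value, additivity, commutation with bounded
    operators, invariance under almost everywhere equality, and existence for
    strongly measurable functions with integrable norm
    ([bochner_integrableP]).  The integral of a norm is a supremum over Borel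
    simple functions, while a strongly measurable function is a limit of simple
    functions only off a null set, so its norm is in general not Borel
    measurable.  The lemmas [ae_le_lower_integral] and
    [strongly_measurable_rnorm] reduce all estimates to Borel representatives.

    Integrability of [s |-> U t s (f s)] combines two facts.  Strong
    measurability survives composition with strongly continuous operator
    families: one replaces both the vector [f s] and the parameter [s] by simple
    approximations at once ([strongly_measurable_strongly_continuous]).  The
    norm is dominated by that of [f].  Finally, the disturbance is
    only known to be square integrable on intervals away from [0]; periodicity
    and translation invariance of the Lebesgue measure give integrability on
    the first period ([periodic_L1]). *)

(** * The real-valued norm and completeness *)

Section rnorm_theory.
Variables (R : realType) (V : normedModType R[i]).
Implicit Types x y : V.

(** Nonnegative elements of [R[i]] are real, so nothing of the norm is lost when
    its real part is taken. *)
Lemma normE x : `|x| = (rnorm x)%:C.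
Proof.
have := normr_ge0 x; rewrite /rnorm; case: `|x| => a b /=.
by rewrite lecE /= => /andP[/eqP -> _].
Qed.

Lemma rnorm_ge0 x : 0 <= rnorm x.
Proof. by have := normr_ge0 x; rewrite normE lecR. Qed.

Lemma rnormD x y : rnorm (x + y) <= rnorm x + rnorm y.
Proof. by have := ler_normD x y; rewrite !normE -rmorphD lecR. Qed.

Lemma rnormN x : rnorm (- x) = rnorm x.
Proof. by rewrite /rnorm normrN. Qed.

Lemma rnorm_distC x y : rnorm (x - y) = rnorm (y - x).
Proof. by rewrite /rnorm distrC. Qed.

Lemma rnormB x y : rnorm (x - y) <= rnorm x + rnorm y.
Proof. by rewrite -(rnormN y) rnormD. Qed.

Lemma rnorm_dist_triangle x y z : rnorm (x - z) <= rnorm (x - y) + rnorm (y - z).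
Proof. by rewrite -{1}(subrK y x) -addrA rnormD. Qed.

Lemma rnorm0 : rnorm (0 : V) = 0.
Proof. by rewrite /rnorm normr0. Qed.

Lemma rnorm_eq0 x : rnorm x = 0 -> x = 0.
Proof. by move=> h; apply/eqP; rewrite -normr_eq0 normE h. Qed.

Lemma rnormZ (c : R[i]) x : rnorm (c *: x) = complex.Re `|c| * rnorm x.
Proof. by rewrite /rnorm normrZ (normE x) normc_def -rmorphM. Qed.

Lemma rnormZr (r : R) x : rnorm (r%:C *: x) = `|r| * rnorm x.
Proof. by rewrite rnormZ normc_def /= expr0n addr0 sqrtr_sqr. Qed.

Lemma ler_rnorm_sum (I : Type) (r : seq I) (P : pred I) (F : I -> V) :
  rnorm (\sum_(i <- r | P i) F i) <= \sum_(i <- r | P i) rnorm (F i).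
Proof.
apply: (big_ind2 (fun a b => rnorm a <= b)); first by rewrite rnorm0.
  by move=> x1 x2 y1 y2 h1 h2; apply: (le_trans (rnormD _ _)); rewrite lerD.
by [].
Qed.

(** The topology is that of the [R[i]]-valued norm; a positive radius in [R[i]]
    is a positive real, so real radii suffice. *)
Lemma cvg_rnormP T (F : set_system T) {FF : Filter F} (f : T -> V) (l : V) :
  f @ F --> l <-> rnorm (f t - l) @[t --> F] --> (0 : R).
Proof.
split => [/cvgrPdist_lt h|/cvgrPdist_lt h]; apply/cvgrPdist_lt => e e0.
  have e0' : 0 < e%:C :> R[i] by rewrite ltcR.
  near=> t; rewrite sub0r normrN ger0_norm ?rnorm_ge0// rnorm_distC -ltcR -normE.
  by near: t; exact: h.
have : 0 < complex.Re e by move: e0; rewrite ltcE => /andP[].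
have eE : e = (complex.Re e)%:C by case: e e0 => a b /=; rewrite ltcE /= => /andP[/eqP -> _].
move=> /h {}h; near=> t; rewrite eE normE ltcR rnorm_distC.
have : `|0 - rnorm (f t - l)| < complex.Re e by near: t.
by rewrite sub0r normrN ger0_norm ?rnorm_ge0.
Unshelve. all: by end_near. Qed.

Lemma cvg_rnorm T (F : set_system T) {FF : Filter F} (f : T -> V) (l : V) :
  f @ F --> l -> rnorm (f t) @[t --> F] --> rnorm l.
Proof.
move=> /cvg_rnormP /cvgrPdist_lt h; apply/cvgrPdist_lt => e e0; near=> t.
have : `|0 - rnorm (f t - l)| < e by near: t; exact: h.
rewrite sub0r normrN ger0_norm ?rnorm_ge0//; apply: le_lt_trans.
have h1 := rnormD (f t - l) l; have h2 := rnormD (l - f t) (f t).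
rewrite !subrK in h1 h2; rewrite rnorm_distC in h2.
by rewrite ler_norml; apply/andP; split; lra.
Unshelve. all: by end_near. Qed.

Lemma cvg_rnorm_squeeze T (F : set_system T) {FF : Filter F} (f : T -> V) (l : V)
    (g : T -> R) :
  (\forall t \near F, rnorm (f t - l) <= g t) -> g @ F --> (0 : R) -> f @ F --> l.
Proof.
move=> h g0; apply/cvg_rnormP; apply: (@squeeze_cvgr _ _ _ _ (cst 0) g) => //.
  by near=> t; rewrite rnorm_ge0/=; near: t.
exact: cvg_cst.
Unshelve. all: by end_near. Qed.

End rnorm_theory.

Lemma linear_bound_cvg (R : realType) (V W : normedModType R[i]) (T : V -> W) (K : R) :
  linear T -> (forall x, rnorm (T x) <= K * rnorm x) ->
  forall I (F : set_system I) {FF : Filter F} (f : I -> V) (l : V),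
    f @ F --> l -> T (f t) @[t --> F] --> T l.
Proof.
move=> linT bT I F FF f l fl.
apply: (@cvg_rnorm_squeeze _ _ _ _ _ _ _ (fun t => K * rnorm (f t - l))).
  apply: nearW => t; apply: le_trans (bT _).
  by rewrite (addrC (T (f t))) -scaleN1r -linT scaleN1r addrC.
rewrite -(mulr0 K); apply: cvgM; first exact: cvg_cst.
by move/cvg_rnormP : fl.
Qed.

Lemma rnorm_cauchy_cvg (R : realType) (V : completeNormedModType R[i]) (u : nat -> V) :
  (forall e : R, 0 < e -> exists N, forall n m, (N <= n)%N -> (N <= m)%N ->
    rnorm (u n - u m) < e) -> exists l : V, u n @[n --> \oo] --> l.
Proof.
move=> h; suff c : cvg (u n @[n --> \oo]) by exists (lim (u n @[n --> \oo])).
apply/cauchy_cvgP/cauchy_ballP => e e0; near_simpl.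
have Re0 : 0 < complex.Re e by move: e0; rewrite ltcE => /andP[].
have eE : e = (complex.Re e)%:C by case: e e0 {Re0} => a b /=; rewrite ltcE /= => /andP[/eqP -> _].
have [N hN] := h _ Re0.
near=> n m => /=; rewrite -ball_normE/= eE normE ltcR.
apply: hN; [near: n|near: m]; exact: nbhs_infty_ge.
Unshelve. all: by end_near. Qed.

(** * Simple functions and their integrals *)

Section simple_functions.
Variable R : realType.
Local Notation mu := (@lebesgue_measure R).

(** A simple function takes finitely many values, so the preimage of any set,
    measurable or not, is a finite union of measurable level sets. *)
Lemma simple_preimage (T : Type) (s : R -> T) (A : set T) :
  simple_function s -> measurable (s @^-1` A : set (measurableTypeR R)).
Proof.
move=> [fs ms].
rewrite (_ : s @^-1` A = \bigcup_(x in range s `&` A) s @^-1` [set x]).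
  apply: fin_bigcup_measurable => //; exact: finite_setIl.
apply/seteqP; split => [t /= At|t [x [_ Ax] /= ->//]].
by exists (s t) => //; split => //; exists t.
Qed.

Lemma simple_comp (T T' : Type) (phi : T -> T') (s : R -> T) :
  simple_function s -> simple_function (phi \o s).
Proof.
move=> ss; split; last by move=> x; exact: (@simple_preimage _ _ (phi @^-1` [set x])).
by rewrite -(image_comp s phi); apply: finite_image; case: ss.
Qed.

Lemma simple_pair (T T' : Type) (s : R -> T) (s' : R -> T') :
  simple_function s -> simple_function s' ->
  simple_function (fun t => (s t, s' t)).
Proof.
move=> ss ss'; split.
  apply: (@sub_finite_set _ _ (range s `*` range s')).
    by move=> _ [t _ <-]; split; exists t.
  by apply: finite_setX; [case: ss|case: ss'].
move=> [x x']; rewrite (_ : _ @^-1` _ = s @^-1` [set x] `&` s' @^-1` [set x']).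
  by apply: measurableI; exact: simple_preimage.
by apply/seteqP; split => t /= [-> ->].
Qed.

Lemma simple_indicator (A : set (measurableTypeR R)) : measurable A ->
  simple_function (fun t => `[< A t >]).
Proof.
move=> mA; split; first exact: (@sub_finite_set _ _ setT).
have h (b : bool) : (fun t => `[< A t >]) @^-1` [set b] = if b then A else ~` A.
  apply/seteqP; case: b; split => t /=.
  - by move/asboolP.
  - by move=> ?; apply/asboolP.
  - by move/asboolP.
  - by move=> ?; apply/asboolP.
by case; rewrite h//; exact: measurableC.
Qed.

Lemma simple_measurable (s : R -> R) : simple_function s ->
  measurable_fun [set: measurableTypeR R] (s : measurableTypeR R -> R).
Proof. by move=> ss _ B _; rewrite setTI; exact: simple_preimage. Qed.

(** The tool for computing with simple integrals: the level sets of [phi \o p]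
    are finite unions of those of [p].  Two simple functions are handled at
    once by taking for [p] the pair of them. *)
Lemma simple_integral_comp (V : normedModType R[i]) (T : choiceType)
    (phi : T -> V) (p : R -> T) (a b : R) : simple_function p ->
  simple_integral a b (phi \o p) =
  \sum_(y \in range p) (fine (mu (`[a, b] `&` p @^-1` [set y])))%:C *: phi y.
Proof.
move=> sp; have fp := sp.1.
pose m y : R := fine (mu (`[a, b] `&` p @^-1` [set y])).
have fphi : finite_set (range (phi \o p)) by have [] := simple_comp phi sp.
transitivity (\sum_(x \in range (phi \o p)) \sum_(y \in range p)
   (if phi y == x then m y else 0)%:C *: x).
  apply: eq_fsbigr => x _.
  rewrite fsbig_finite//= -scaler_suml -rmorph_sum -fsbig_finite//=.
  congr (_%:C *: _).
  have mI y : measurable (`[a, b] `&` p @^-1` [set y] : set (measurableTypeR R)).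
    by apply: measurableI; [exact: measurable_itv|exact: simple_preimage].
  have finm y : mu (`[a, b] `&` p @^-1` [set y]) \is a fin_num.
    rewrite ge0_fin_numE//; apply: (@le_lt_trans _ _ (mu `[a, b])).
      by apply: le_measure; rewrite ?inE//; apply: measurable_itv.
    by rewrite lebesgue_measure_itv/=; case: ifP => // _; rewrite -EFinB ltry.
  (* The level set of [phi \o p] at [x] splits into the level sets of [p] at the
     points of the fibre of [phi] over [x]. *)
  pose F y : set (measurableTypeR R) :=
    if phi y == x then `[a, b] `&` p @^-1` [set y] else set0.
  rewrite (_ : _ `&` _ = \bigcup_(y in range p) F y); last first.
    apply/seteqP; split => [t [/= abt ptx]|t [y [u _ /= <-]]].
      by exists (p t); [exists t|rewrite /F ptx eqxx].
    by rewrite /F; case: eqP => // ux [abt /= ptu]; split => //=; rewrite ptu ux.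
  rewrite measure_fin_bigcup//; first last.
  - by move=> y _; rewrite /F; case: ifP.
  - move=> y z _ _ [t []]; rewrite /F.
    by case: ifP => // _ [_ /= <-]; case: ifP => // _ [_ /= <-].
  rewrite -[RHS]/(fine (_%:E)) -fsumEFin//; congr fine; apply: eq_fsbigr => y _.
  by rewrite /F; case: ifP => _; rewrite ?measure0 /m ?fineK.
rewrite exchange_fsbig//; apply: eq_fsbigr => y; rewrite inE => -[t _ <-].
rewrite (_ : range _ = [set phi (p t)] `|` range (phi \o p)); last first.
  by apply/esym/setUidr => _ ->; exists t.
rewrite -(@fsbig_widen _ _ _ _ [set phi (p t)]).
- by rewrite fsbig_set1 eqxx.
- by move=> x ->; left.
- move=> x [_ /=]; case: eqP => [<- //|_ _]; rewrite ?scale0r//.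
Qed.

Lemma simple_integral_map (V W : normedModType R[i]) (T : V -> W) (s : R -> V)
    (a b : R) : linear T -> simple_function s ->
  T (simple_integral a b s) = simple_integral a b (T \o s).
Proof.
move=> linT ss; rewrite (simple_integral_comp T)// /simple_integral.
have [T' TE] : exists T' : {linear V -> W}, T = T'.
  by exists (HB.pack_for {linear V -> W} T (GRing.isLinear.Build _ V W _ T linT)).
have fs := ss.1; rewrite !fsbig_finite//= TE linear_sum.
by apply: eq_bigr => x _; rewrite linearZ.
Qed.

Lemma simple_integralD (V : normedModType R[i]) (s s' : R -> V) (a b : R) :
  simple_function s -> simple_function s' ->
  simple_integral a b (s \+ s') = simple_integral a b s + simple_integral a b s'.
Proof.
move=> ss ss'; have sp := simple_pair ss ss'.
have /= E1 := simple_integral_comp (@fst V V) a b sp.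
have /= E2 := simple_integral_comp (@snd V V) a b sp.
have /= E3 := simple_integral_comp (fun z : V * V => z.1 + z.2) a b sp.
rewrite [in LHS]/simple_integral in E3 *; rewrite [LHS]E3.
rewrite [X in _ = X + _]E1 [X in _ = _ + X]E2.
by rewrite -fsbig_split//=; [under eq_fsbigr do rewrite scalerDr|exact: sp.1].
Qed.

Lemma simple_integralN (V : normedModType R[i]) (s : R -> V) (a b : R) :
  simple_function s ->
  simple_integral a b (fun t => - s t) = - simple_integral a b s.
Proof.
move=> ss; rewrite (@simple_integral_map _ _ (fun x => - x))// => k x y.
by rewrite opprD scalerN.
Qed.

Lemma integral_rnorm_simple (V : normedModType R[i]) (s : R -> V) (a b : R) :
  simple_function s ->
  (\int[mu]_(t in `[a, b]) (rnorm (s t))%:E =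
   \sum_(x \in range s) (rnorm x)%:E * mu (`[a, b] `&` s @^-1` [set x]))%E.
Proof.
move=> ss; have fs := ss.1.
have mx x : measurable (s @^-1` [set x] : set (measurableTypeR R)).
  exact: simple_preimage.
have mab : measurable (`[a, b]%classic : set (measurableTypeR R)) by exact: measurable_itv.
transitivity (\int[mu]_(t in `[a, b]) \sum_(x \in range s)
    (rnorm x)%:E * (\1_(s @^-1` [set x] : set (measurableTypeR R)) t)%:E)%E.
  apply: eq_integral => t _; rewrite -(@fsbig_widen _ _ _ _ [set s t]).
  - by rewrite fsbig_set1 indicE mem_set// mule1.
  - by move=> _ ->; exists t.
  - by move=> x [_ /= xs]; rewrite indicE memNset ?mule0//= => h; apply: xs.
rewrite ge0_integral_fsum//.
- apply: eq_fsbigr => x _; rewrite ge0_integralZl_EFin ?rnorm_ge0//.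
    by rewrite integral_indic// setIC.
  by apply/measurable_EFinP/measurable_funTS; exact: measurable_indic.
- move=> x; apply/measurable_EFinP; apply: measurable_funM; first exact: measurable_cst.
  by apply/measurable_funTS; exact: measurable_indic.
- by move=> x t _; rewrite mule_ge0// lee_fin rnorm_ge0.
Qed.

(** The triangle inequality for integrals of simple functions; everything about
    the Bochner integral is deduced from it by density. *)
Lemma rnorm_simple_integral_le (V : normedModType R[i]) (s : R -> V) (a b : R) :
  simple_function s ->
  ((rnorm (simple_integral a b s))%:E <= \int[mu]_(t in `[a, b]) (rnorm (s t))%:E)%E.
Proof.
move=> ss; have fs := ss.1; rewrite integral_rnorm_simple// /simple_integral.
rewrite !fsbig_finite//=.
have := ler_rnorm_sum (finmap.enum_fset (fset_set (range s))) xpredT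
  (fun x => (fine (mu (`[a, b] `&` s @^-1` [set x])))%:C *: x).
rewrite -lee_fin => /le_trans; apply.
rewrite -sumEFin lee_sum// => x _; rewrite rnormZr mulrC EFinM.
have mabx : measurable (`[a, b] `&` s @^-1` [set x] : set (measurableTypeR R)).
  by apply: measurableI; [exact: measurable_itv|exact: simple_preimage].
rewrite lee_wpmul2l ?lee_fin ?rnorm_ge0// ger0_norm ?fine_ge0//.
rewrite fineK// ge0_fin_numE//; apply: (@le_lt_trans _ _ (mu `[a, b])).
  by apply: le_measure; rewrite ?inE//; exact: measurable_itv.
by rewrite lebesgue_measure_itv/=; case: ifP => // _; rewrite -EFinB ltry.
Qed.
End simple_functions.

(** * Lower integrals of norms and strong measurability *)

(** Monotonicity without any measurability of [f] and [g]: a Borel simple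
    function below [f] can be set to zero on the exceptional null set, which
    does not change its integral and puts it below [g]. *)
Lemma ae_le_lower_integral d (T : measurableType d) (R : realType)
    (mu : {measure set T -> \bar R}) (D : set T) (f g : T -> \bar R) :
  (forall t, D t -> 0 <= f t)%E -> (forall t, D t -> 0 <= g t)%E ->
  {ae mu, forall t, D t -> (f t <= g t)%E} ->
  (\int[mu]_(t in D) f t <= \int[mu]_(t in D) g t)%E.
Proof.
move=> f0 g0 [N [mN N0 fgN]].
rewrite !ge0_integralE//; apply: ge_ereal_sup => _ [h /= hf <-].
pose h' := proj_nnsfun h (measurableC mN).
apply: ereal_sup_ubound; exists h'.
  move=> t; rewrite /h' /= mindicE patchE.
  have [tN|tN] := boolP (t \in ~` N); last first.
    by rewrite mulr0; case: ifPn => // /set_mem; exact: g0.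
  rewrite mulr1; apply: (le_trans (hf t)); rewrite patchE.
  case: ifPn => // /set_mem Dt; apply: contrapT => fg.
  by move: tN; rewrite inE; apply; apply: fgN => /(_ Dt).
rewrite -!integralT_nnsfun; apply: ge0_ae_eq_integral => //.
- exact/measurable_EFinP.
- exact/measurable_EFinP.
- by move=> t _; rewrite lee_fin.
- by move=> t _; rewrite lee_fin.
exists N; split => // t /= ht; apply: contrapT => Nt; apply: ht => _.
by rewrite mindicE mem_set//= mulr1.
Qed.

#[global] Instance lebesgue_ae_filter (R : realType) :
  Filter (nbhs (almost_everywhere (@lebesgue_measure R))).
Proof. exact: ae_filter_ringOfSetsType. Qed.

Section strong_measurability.
Variable R : realType.
Local Notation mu := (@lebesgue_measure R).
Implicit Types V W : normedModType R[i].

(** A strongly measurable function agrees almost everywhere on [D] with an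
    everywhere pointwise limit of simple functions. *)
Lemma strongly_measurable_version V (D : set (measurableTypeR R)) (f : R -> V) :
  measurable D -> strongly_measurable D f ->
  exists (N : set (measurableTypeR R)) (s : nat -> R -> V),
    [/\ measurable N, mu N = 0%E, forall n, simple_function (s n) &
      forall t, s n t @[n --> \oo] --> (if `[< (D `\` N) t >] then f t else 0)].
Proof.
move=> mD [s ss [N [mN N0 sN]]]; exists N.
exists (fun n t => if `[< (D `\` N) t >] then s n t else 0); split => //.
  move=> n; have mDN : measurable (D `\` N) by exact: measurableD.
  have := simple_comp (fun z : bool * V => if z.1 then z.2 else 0)
    (simple_pair (simple_indicator mDN) (ss n)).
  by [].
move=> t; case: asboolP => [[Dt Nt]|_]; last exact: cvg_cst.
by apply: contrapT => h; apply: Nt; apply: sN => /(_ Dt).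
Qed.

(** Lebesgue null sets need not be Borel, so [rnorm \o f] itself may fail to be
    measurable; the integral calculus is applied to the representative [g]. *)
Lemma strongly_measurable_rnorm V (D : set (measurableTypeR R)) (f : R -> V) :
  measurable D -> strongly_measurable D f ->
  exists g : measurableTypeR R -> R,
    [/\ measurable_fun setT g, forall t, 0 <= g t &
      {ae mu, forall t, D t -> rnorm (f t) = g t}].
Proof.
move=> mD /(strongly_measurable_version mD) [N [s [mN N0 ss sf]]].
exists (fun t => rnorm (if `[< (D `\` N) t >] then f t else 0)); split.
- apply: (@measurable_fun_cvg _ _ _ _ (fun n t => rnorm (s n t))).
    by move=> n; apply: simple_measurable; exact: (simple_comp (@rnorm R V)).
  by move=> t _; apply: cvg_rnorm; exact: sf.
- by move=> t; exact: rnorm_ge0.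
- exists N; split => // t /= h; apply: contrapT => Nt; apply: h => Dt.
  by case: asboolP => // -[].
Qed.

Lemma ge0_integral_rnorm V (D : set R) (f : R -> V) :
  (0 <= \int[mu]_(t in D) (rnorm (f t))%:E)%E.
Proof. by apply: integral_ge0 => t _; rewrite lee_fin rnorm_ge0. Qed.

(** Lower integrals are superadditive only; the subadditivity stated here holds
    because the norms of [f] and [g] have Borel representatives. *)
Lemma integral_rnorm_le_lincomb V W (Z : normedModType R[i])
    (D : set (measurableTypeR R)) (f : R -> V) (g : R -> W) (h : R -> Z)
    (p q : R) :
  measurable D -> strongly_measurable D f -> strongly_measurable D g ->
  0 <= p -> 0 <= q ->
  {ae mu, forall t, D t -> rnorm (h t) <= p * rnorm (f t) + q * rnorm (g t)} ->
  (\int[mu]_(t in D) (rnorm (h t))%:E <=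
   p%:E * \int[mu]_(t in D) (rnorm (f t))%:E +
   q%:E * \int[mu]_(t in D) (rnorm (g t))%:E)%E.
Proof.
move=> mD /(strongly_measurable_rnorm mD) [f' [mf' f'0 ff']].
move=> /(strongly_measurable_rnorm mD) [g' [mg' g'0 gg']] p0 q0 hfg.
apply: (@le_trans _ _ (\int[mu]_(t in D) (p * f' t + q * g' t)%:E)%E).
  apply: ae_le_lower_integral.
  - by move=> t _; rewrite lee_fin rnorm_ge0.
  - by move=> t _; rewrite lee_fin addr_ge0// mulr_ge0.
  by apply: filterS3 ff' gg' hfg => t + + + Dt => <-// <-// => /(_ Dt).
rewrite (eq_integral (fun t => p%:E * (f' t)%:E + q%:E * (g' t)%:E)%E)//.
have mf'D : measurable_fun D (EFin \o f') by apply/measurable_EFinP/measurable_funTS.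
have mg'D : measurable_fun D (EFin \o g') by apply/measurable_EFinP/measurable_funTS.
rewrite ge0_integralD//; last 4 first.
- by move=> t _; rewrite mule_ge0 ?lee_fin.
- exact: measurable_funeM.
- by move=> t _; rewrite mule_ge0 ?lee_fin.
- exact: measurable_funeM.
rewrite !ge0_integralZl_EFin//; try by move=> t _; rewrite lee_fin.
apply: leeD; apply: lee_wpmul2l; rewrite ?lee_fin//; apply: ae_le_lower_integral.
- by move=> t _; rewrite lee_fin.
- by move=> t _; rewrite lee_fin rnorm_ge0.
- by apply: filterS ff' => t h1 Dt; rewrite h1.
- by move=> t _; rewrite lee_fin.
- by move=> t _; rewrite lee_fin rnorm_ge0.
- by apply: filterS gg' => t h1 Dt; rewrite h1.
Qed.

Lemma strongly_measurable_simple V D (s : R -> V) :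
  simple_function s -> strongly_measurable D s.
Proof.
by move=> ss; exists (fun=> s) => //; apply: aeW => t _; exact: cvg_cst.
Qed.

Lemma strongly_measurable_ae V D (f g : R -> V) :
  {ae mu, forall t, D t -> f t = g t} ->
  strongly_measurable D f -> strongly_measurable D g.
Proof.
move=> fg [s ss sf]; exists s => //.
by apply: filterS2 fg sf => t + + Dt => <-// /(_ Dt).
Qed.

(** Only sequential continuity of [phi] is asked for, so that sums, differences
    and bounded linear maps are all covered. *)
Lemma strongly_measurable_map2 V W (Z : normedModType R[i]) D
    (phi : V -> W -> Z) (f : R -> V) (g : R -> W) :
  (forall (u : nat -> V) (v : nat -> W) x y, u n @[n --> \oo] --> x ->
     v n @[n --> \oo] --> y -> phi (u n) (v n) @[n --> \oo] --> phi x y) ->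
  strongly_measurable D f -> strongly_measurable D g ->
  strongly_measurable D (fun t => phi (f t) (g t)).
Proof.
move=> cphi [s ss sf] [s' ss' s'g]; exists (fun n t => phi (s n t) (s' n t)).
  move=> n; exact: (simple_comp (fun z => phi z.1 z.2) (simple_pair (ss n) (ss' n))).
by apply: filterS2 sf s'g => t h h' Dt; apply: cphi; [exact: h|exact: h'].
Qed.

Lemma strongly_measurableD V D (f g : R -> V) :
  strongly_measurable D f -> strongly_measurable D g ->
  strongly_measurable D (f \+ g).
Proof. by apply: (strongly_measurable_map2 (phi := +%R)) => *; exact: cvgD. Qed.

Lemma strongly_measurableB V D (f g : R -> V) :
  strongly_measurable D f -> strongly_measurable D g ->
  strongly_measurable D (fun t => f t - g t).
Proof.
by apply: (strongly_measurable_map2 (phi := fun x y => x - y)) => *; exact: cvgB.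
Qed.

Lemma strongly_measurable_linear V W D (T : V -> W) K (f : R -> V) :
  linear T -> (forall x, rnorm (T x) <= K * rnorm x) ->
  strongly_measurable D f -> strongly_measurable D (T \o f).
Proof.
move=> linT bT mf.
apply: (strongly_measurable_map2 (phi := fun x _ => T x) _ mf mf) => u _ x _ ux _.
exact: (linear_bound_cvg linT bT).
Qed.

End strong_measurability.

(** * Uniqueness, additivity and linearity of the Bochner integral *)

Lemma cvge0_lt (R : realType) (u : nat -> \bar R) : u n @[n --> \oo] --> 0%E ->
  forall e : R, 0 < e -> \forall n \near \oo, (u n < e%:E)%E.
Proof.
move=> /fine_cvgP [finu /cvgrPdist_lt h] e e0; near=> n.
have fn : u n \is a fin_num by near: n.
have : `|0 - fine (u n)| < e by near: n; exact: h.
rewrite sub0r normrN -(fineK fn) lte_fin; apply: le_lt_trans; exact: ler_norm.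
Unshelve. all: by end_near. Qed.

Section bochner_integral_theory.
Variable R : realType.
Local Notation mu := (@lebesgue_measure R).
Implicit Types V W : normedModType R[i].

Let mitv (a b : R) : measurable (`[a, b]%classic : set (measurableTypeR R)).
Proof. exact: measurable_itv. Qed.

(** Both the uniqueness of the Bochner integral and the Cauchy property behind
    its existence are instances of this bound. *)
Lemma simple_integral_dist V (a b : R) (f s s' : R -> V) :
  strongly_measurable `[a, b] f -> simple_function s -> simple_function s' ->
  ((rnorm (simple_integral a b s - simple_integral a b s'))%:E <=
   \int[mu]_(t in `[a, b]) (rnorm (f t - s t))%:E +
   \int[mu]_(t in `[a, b]) (rnorm (f t - s' t))%:E)%E.
Proof.
move=> mf ss ss'.
have sN : simple_function (fun t => - s' t) by exact: (simple_comp -%R).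
rewrite -simple_integralN// -simple_integralD//.
have sD : simple_function (s \+ (fun t => - s' t)).
  exact: (simple_comp (fun z => z.1 + z.2) (simple_pair ss sN)).
apply: (le_trans (rnorm_simple_integral_le a b sD)).
rewrite -[X in (_ <= X + _)%E]mul1e -[X in (_ <= _ + X)%E]mul1e.
apply: integral_rnorm_le_lincomb => //.
- by apply: strongly_measurableB => //; exact: strongly_measurable_simple.
- by apply: strongly_measurableB => //; exact: strongly_measurable_simple.
apply: aeW => t _; rewrite !mul1r (rnorm_distC (f t) (s t)).
exact: rnorm_dist_triangle.
Qed.

Lemma is_bochner_integral_unique V (a b : R) (f : R -> V) v w :
  is_bochner_integral a b f v -> is_bochner_integral a b f w -> v = w.
Proof.
move=> [mf [s [ss sf sv]]] [_ [s' [ss' sf' sw]]].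
apply/subr0_eq/rnorm_eq0/le_anti; rewrite rnorm_ge0 andbT.
apply/ler_addgt0Pr => e e0; rewrite add0r.
have e4 : 0 < e / 4 by lra.
have {}sv : \forall n \near \oo, rnorm (simple_integral a b (s n) - v) < e / 4.
  move/cvg_rnormP : sv => /cvgrPdist_lt /(_ _ e4); apply: filterS => n.
  by rewrite sub0r normrN ger0_norm ?rnorm_ge0.
have {}sw : \forall n \near \oo, rnorm (simple_integral a b (s' n) - w) < e / 4.
  move/cvg_rnormP : sw => /cvgrPdist_lt /(_ _ e4); apply: filterS => n.
  by rewrite sub0r normrN ger0_norm ?rnorm_ge0.
near \oo => n.
have h1 : rnorm (simple_integral a b (s n) - v) < e / 4 by near: n.
have h2 : rnorm (simple_integral a b (s' n) - w) < e / 4 by near: n.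
have h3 : rnorm (simple_integral a b (s n) - simple_integral a b (s' n)) < e / 4 + e / 4.
  rewrite -lte_fin; apply: le_lt_trans (simple_integral_dist mf (ss n) (ss' n)) _.
  by rewrite EFinD lteD//; near: n; exact: cvge0_lt.
have h4 := rnorm_dist_triangle v (simple_integral a b (s n)) w.
have h5 := rnorm_dist_triangle (simple_integral a b (s n)) (simple_integral a b (s' n)) w.
rewrite rnorm_distC in h1; lra.
Unshelve. all: by end_near. Qed.

Lemma bochner_integralE V (a b : R) (f : R -> V) v :
  is_bochner_integral a b f v -> bochner_integral a b f = v.
Proof.
move=> fv; rewrite /bochner_integral; case: xgetP => [w _ /= fw|/(_ v)//].
exact: is_bochner_integral_unique fw fv.
Qed.

Lemma is_bochner_integral_ae V (a b : R) (f g : R -> V) v :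
  {ae mu, forall t, `[a, b]%classic t -> f t = g t} ->
  is_bochner_integral a b f v -> is_bochner_integral a b g v.
Proof.
move=> fg [mf [s [ss sf sv]]]; split; first exact: strongly_measurable_ae mf.
exists s; split => //.
apply: (@squeeze_cvge _ _ _ _ (cst 0%E) _ _ _ _ _ sf); last exact: cvg_cst.
apply: nearW => n; rewrite ge0_integral_rnorm//=.
apply: ae_le_lower_integral; [by move=> *; rewrite lee_fin rnorm_ge0..|].
by apply: filterS fg => t h Dt; rewrite h.
Qed.

Lemma is_bochner_integralD V (a b : R) (f g : R -> V) v w :
  is_bochner_integral a b f v -> is_bochner_integral a b g w ->
  is_bochner_integral a b (f \+ g) (v + w).
Proof.
move=> [mf [s [ss sf sv]]] [mg [s' [ss' sg sw]]].
split; first exact: strongly_measurableD.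
exists (fun n => s n \+ s' n); split.
- by move=> n; exact: (simple_comp (fun z => z.1 + z.2) (simple_pair (ss n) (ss' n))).
- have h : (\int[mu]_(t in `[a, b]) (rnorm (f t - s n t))%:E +
    \int[mu]_(t in `[a, b]) (rnorm (g t - s' n t))%:E)%E @[n --> \oo] --> 0%E.
    by rewrite -[X in _ --> X]adde0; apply: cvgeD.
  apply: (@squeeze_cvge _ _ _ _ (cst 0%E) _ _ _ _ _ h); last exact: cvg_cst.
  apply: nearW => n; rewrite ge0_integral_rnorm//=.
  rewrite -[X in (_ <= X + _)%E]mul1e -[X in (_ <= _ + X)%E]mul1e.
  apply: integral_rnorm_le_lincomb => //.
  - by apply: strongly_measurableB => //; exact: strongly_measurable_simple.
  - by apply: strongly_measurableB => //; exact: strongly_measurable_simple.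
  apply: aeW => t _; rewrite !mul1r opprD addrACA; exact: rnormD.
- under eq_cvg do rewrite simple_integralD//.
  exact: cvgD.
Qed.

Lemma is_bochner_integral_linear V W (a b : R) (T : V -> W) K (f : R -> V) v :
  linear T -> (forall x, rnorm (T x) <= K * rnorm x) ->
  is_bochner_integral a b f v -> is_bochner_integral a b (T \o f) (T v).
Proof.
move=> linT bT [mf [s [ss sf sv]]]; split; first exact: strongly_measurable_linear bT mf.
exists (fun n => T \o s n); split.
- by move=> n; exact: simple_comp.
- have h : ((Num.max K 0)%:E * \int[mu]_(t in `[a, b]) (rnorm (f t - s n t))%:E)%E
      @[n --> \oo] --> 0%E.
    by rewrite -[X in _ --> X](mule0 (Num.max K 0)%:E); apply: cvgeZl.
  apply: (@squeeze_cvge _ _ _ _ (cst 0%E) _ _ _ _ _ h); last exact: cvg_cst.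
  apply: nearW => n; rewrite ge0_integral_rnorm//= -[leRHS]adde0.
  rewrite -[X in (_ <= _ + X)%E](mul0e (\int[mu]_(t in `[a, b]) (rnorm (f t - s n t))%:E)%E).
  have m : strongly_measurable `[a, b] (fun t => f t - s n t).
    by apply: strongly_measurableB => //; exact: strongly_measurable_simple.
  apply: integral_rnorm_le_lincomb => //; first by rewrite le_max lexx orbT.
  apply: aeW => t _; rewrite mul0r addr0.
  rewrite (addrC (T _)) -scaleN1r -linT scaleN1r addrC; apply: (le_trans (bT _)).
  by rewrite ler_wpM2r ?rnorm_ge0// le_max lexx.
- under eq_cvg do rewrite -simple_integral_map//.
  exact: (linear_bound_cvg linT bT).
Qed.

End bochner_integral_theory.

(** * Existence of the Bochner integral *)

Section bochner_existence.
Variable R : realType.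
Local Notation mu := (@lebesgue_measure R).

Let mitv (a b : R) : measurable (`[a, b]%classic : set (measurableTypeR R)).
Proof. exact: measurable_itv. Qed.

(** Density of simple functions in [L^1].  An approximating sequence that
    converges pointwise is truncated where it exceeds twice the norm of the
    limit; the truncated sequence has the same limit and is dominated, so that
    dominated convergence applies. *)
Lemma strongly_measurable_L1_approx (V : normedModType R[i]) (a b : R) (f : R -> V) :
  strongly_measurable `[a, b] f ->
  (\int[mu]_(t in `[a, b]) (rnorm (f t))%:E < +oo)%E ->
  exists2 s : nat -> R -> V, forall n, simple_function (s n) &
    (\int[mu]_(t in `[a, b]) (rnorm (f t - s n t))%:E)%E @[n --> \oo] --> 0%E.
Proof.
move=> mf fint; have mab := @mitv a b.
have [N [s [mN N0 ss sf]]] := strongly_measurable_version mab mf.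
set f' := fun t => if `[< (`[a, b] `\` N) t >] then f t else 0.
have ff' : {ae mu, forall t, `[a, b]%classic t -> f t = f' t}.
  exists N; split => // t /= h; apply: contrapT => Nt; apply: h => Dt.
  by rewrite /f'; case: asboolP => // -[].
have mnorm (s' : nat -> R -> V) (l : R -> V) :
    (forall n, simple_function (s' n)) ->
    (forall t, s' n t @[n --> \oo] --> l t) ->
    measurable_fun [set: measurableTypeR R] (fun t => rnorm (l t)).
  move=> ss' sl; apply: (@measurable_fun_cvg _ _ _ _ (fun n t => rnorm (s' n t))).
    by move=> n; apply: simple_measurable; exact: (simple_comp (@rnorm R V)).
  by move=> t _; apply: cvg_rnorm; exact: sl.
have mg := mnorm s f' ss sf; set g := fun t => rnorm (f' t) in mg.
pose A n := [set t : measurableTypeR R | rnorm (s n t) <= 2 * g t].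
have mA n : measurable (A n).
  rewrite -[A n]setTI; apply: measurable_fun_le => //.
    by apply: simple_measurable; exact: (simple_comp (@rnorm R V)).
  exact: measurable_funM.
pose s' n t := if `[< A n t >] then s n t else 0.
have ss' n : simple_function (s' n).
  exact: (simple_comp (fun z : bool * V => if z.1 then z.2 else 0)
    (simple_pair (simple_indicator (mA n)) (ss n))).
exists s' => //; pose h n t := rnorm (f' t - s' n t).
have mh n : measurable_fun [set: measurableTypeR R] (h n).
  apply: (mnorm (fun m t => s m t - s' n t)).
    by move=> m; exact: (simple_comp (fun z => z.1 - z.2) (simple_pair (ss m) (ss' n))).
  by move=> t; apply: cvgB => //; exact: cvg_cst.
have h0 t : h n t @[n --> \oo] --> (0 : R).
  (* Where the limit vanishes the truncation forces the approximants to vanish;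
     elsewhere the truncation is eventually inactive. *)
  have [gt0|gt0] := leP (g t) 0.
    apply: cvg_near_cst; apply: nearW => n; rewrite /h.
    have f't0 : f' t = 0 by apply: rnorm_eq0; apply/le_anti; rewrite gt0 rnorm_ge0.
    rewrite f't0 sub0r rnormN /s'; case: asboolP => [|_]; last exact: rnorm0.
    by rewrite /A /= /g f't0 rnorm0 mulr0 => sle0; apply/le_anti; rewrite sle0 rnorm_ge0.
  have : rnorm (s n t) @[n --> \oo] --> g t by apply: cvg_rnorm; exact: sf.
  move=> /cvgrPdist_lt /(_ _ gt0) close.
  have sft : s n t @[n --> \oo] --> f' t := sf t.
  move/cvg_rnormP : sft; apply: cvg_trans; apply: near_eq_cvg; near=> n.
  rewrite /h /s'; case: asboolP => [_|]; first by rewrite rnorm_distC.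
  case; rewrite /A /=.
  have : `|g t - rnorm (s n t)| < g t by near: n; exact: close.
  by rewrite ltr_norml => /andP[h1 h2]; lra.
have hg n t : h n t <= 3 * g t.
  rewrite /h; apply: (le_trans (rnormB _ _)).
  rewrite /s'; case: asboolP => [|_]; first by rewrite /A /= /g; lra.
  by rewrite rnorm0 /g; have := rnorm_ge0 (f' t); lra.
have g_int : mu.-integrable `[a, b] (EFin \o g).
  apply/integrableP; split; first exact/measurable_EFinP/measurable_funTS.
  apply: le_lt_trans fint; apply: ae_le_lower_integral => //.
  - by move=> t _; rewrite lee_fin rnorm_ge0.
  - by apply: filterS ff' => t e Dt; rewrite e//= ger0_norm ?rnorm_ge0.
have [] := @dominated_convergence _ _ _ mu _ mab (fun n => EFin \o h n) (cst 0%E)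
  (fun t => 3%:E * (g t)%:E)%E.
- by move=> n; exact/measurable_EFinP/measurable_funTS.
- exact: measurable_cst.
- apply: aeW => t _; apply: cvg_EFin; first exact: nearW.
  exact: h0.
- exact: integrableZl.
- by apply: aeW => t n _; rewrite /= lee_fin ger0_norm ?rnorm_ge0.
move=> _ _; rewrite integral0 => hcvg0.
have hcvg : (\int[mu]_(t in `[a, b]) (h n t)%:E)%E @[n --> \oo] --> 0%E by exact: hcvg0.
apply: (@squeeze_cvge _ _ _ _ (cst 0%E) _ _ _ _ _ hcvg); last exact: cvg_cst.
apply: nearW => n; rewrite ge0_integral_rnorm/=.
apply: ae_le_lower_integral.
- by move=> t _; rewrite lee_fin rnorm_ge0.
- by move=> t _; rewrite lee_fin rnorm_ge0.
- by apply: filterS ff' => t e Dt; rewrite e.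
Unshelve. all: by end_near. Qed.

(** The integrals of approximating simple functions form a Cauchy sequence, and
    the space is complete. *)
Lemma bochner_integrableP (V : completeNormedModType R[i]) (a b : R) (f : R -> V) :
  strongly_measurable `[a, b] f ->
  (\int[mu]_(t in `[a, b]) (rnorm (f t))%:E < +oo)%E ->
  bochner_integrable a b f.
Proof.
move=> mf /(strongly_measurable_L1_approx mf) [s ss sf].
have [v sv] : exists v : V, simple_integral a b (s n) @[n --> \oo] --> v.
  apply: (@rnorm_cauchy_cvg _ V (fun n => simple_integral a b (s n))) => e e0; have e2 : 0 < e / 2 by lra.
  have [N _ hN] := cvge0_lt sf e2.
  exists N => n m Nn Nm; rewrite -lte_fin.
  apply: le_lt_trans (simple_integral_dist mf (ss n) (ss m)) _.
  rewrite [e in X in (_ < X)%E](_ : e = e / 2 + e / 2); last by lra.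
  by rewrite EFinD lteD//; exact: hN.
by exists v; split => //; exists s.
Qed.

End bochner_existence.

(** * Translation invariance and periodic signals *)

Section translation.
Variable R : realType.
Local Notation mu := (@lebesgue_measure R).

Definition translate (c : R) (t : measurableTypeR R) : measurableTypeR R := t + c.

Lemma measurable_translate c : measurable_fun setT (translate c).
Proof. by apply: measurable_funD; [exact: measurable_id|exact: measurable_cst]. Qed.

Lemma translate_preimage c (A : set (measurableTypeR R)) : measurable A ->
  measurable (translate c @^-1` A).
Proof.
by move=> mA; rewrite -[_ @^-1` _]setTI; exact: measurable_translate.
Qed.

(** The image of the Lebesgue measure under a translation gives half-open
    intervals their length, which characterizes the Lebesgue measure. *)
Lemma lebesgue_measure_translate c (A : set (measurableTypeR R)) : measurable A ->
  mu (translate c @^-1` A) = mu A.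
Proof.
move=> mA; rewrite -[LHS]/(pushforward mu (translate c) A).
apply/esym/(@lebesgue_measure_unique R (pushforward mu (translate c))) => //.
  exact: measurable_translate.
move=> _ _ [[x y] _ <-] /=; rewrite /pushforward.
rewrite (_ : translate c @^-1` _ = `]x - c, y - c]%classic).
  rewrite !lebesgue_measure_itv/= !lte_fin ltrD2r; case: ifP => // _.
  by rewrite -!EFinD; congr (_%:E); ring.
by apply/seteqP; split => t /=; rewrite !in_itv/= ltrBlDr lerBrDr.
Qed.

Lemma ae_translate c (P : R -> Prop) :
  {ae mu, forall t, P t} -> {ae mu, forall t, P (t + c)}.
Proof.
move=> [N [mN N0 PN]]; exists (translate c @^-1` N); split.
- exact: translate_preimage.
- by rewrite lebesgue_measure_translate.
- by move=> t /= nP; apply: PN.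
Qed.

Lemma strongly_measurable_translate (V : normedModType R[i]) c (D : set R)
    (f : R -> V) : strongly_measurable D f ->
  strongly_measurable (translate c @^-1` D) (fun t => f (t + c)).
Proof.
move=> [s ss /(ae_translate c) sf]; exists (fun n t => s n (t + c)) => // n.
split; first by apply: (sub_finite_set _ (ss n).1) => _ [t _ <-]; exists (t + c).
by move=> x; exact: (translate_preimage c ((ss n).2 x)).
Qed.

Lemma integral_rnorm_translate (V : normedModType R[i]) c
    (D : set (measurableTypeR R)) (f : R -> V) :
  measurable D -> strongly_measurable D f ->
  (\int[mu]_(t in translate c @^-1` D) (rnorm (f (t + c)))%:E <=
   \int[mu]_(t in D) (rnorm (f t))%:E)%E.
Proof.
move=> mD /(strongly_measurable_rnorm mD) [g [mg g0 fg]].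
apply: (@le_trans _ _ (\int[mu]_(t in translate c @^-1` D) (g (t + c))%:E)%E).
  apply: ae_le_lower_integral.
  - by move=> t _; rewrite lee_fin rnorm_ge0.
  - by move=> t _; rewrite lee_fin.
  - by apply: filterS (ae_translate c fg) => t h Dt; rewrite h.
apply: (@le_trans _ _ (\int[mu]_(t in D) (g t)%:E)%E); last first.
  apply: ae_le_lower_integral.
  - by move=> t _; rewrite lee_fin.
  - by move=> t _; rewrite lee_fin rnorm_ge0.
  - by apply: filterS fg => t h Dt; rewrite h.
have mgD : measurable_fun D (EFin \o g) by apply/measurable_EFinP/measurable_funTS.
have := @ge0_integral_pushforward _ _ _ _ R (translate c) (measurable_translate c)
  mu D (EFin \o g) mD mgD.
move=> <-; last by move=> t _; rewrite lee_fin.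
rewrite le_eqVlt; apply/orP; left; apply/eqP.
apply: eq_measure_integral; first exact: measurable_translate.
by move=> mtr A mA _; exact: lebesgue_measure_translate.
Qed.

(** On a bounded interval, because [r <= 1 + r ^+ 2]. *)
Lemma L2_L1 (V : normedModType R[i]) (a b : R) (f : R -> V) : L2 a b f ->
  (\int[mu]_(t in `[a, b]) (rnorm (f t))%:E < +oo)%E.
Proof.
move=> [mf f2]; have mab : measurable (`[a, b]%classic : set (measurableTypeR R)).
  exact: measurable_itv.
have [g [mg g0 fg]] := strongly_measurable_rnorm mab mf.
apply: (@le_lt_trans _ _ (\int[mu]_(t in `[a, b]) (1 + (g t ^+ 2)%:E))%E).
  apply: ae_le_lower_integral.
  - by move=> t _; rewrite lee_fin rnorm_ge0.
  - by move=> t _; rewrite -EFinD lee_fin; nra.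
  - by apply: filterS fg => t h Dt; rewrite h// -EFinD lee_fin; nra.
have mg2 : measurable_fun (`[a, b]%classic : set (measurableTypeR R))
    (fun t => (g t ^+ 2)%:E).
  by apply/measurable_EFinP/measurable_funTS; exact: measurable_funX.
rewrite ge0_integralD//; last by move=> t _; rewrite lee_fin sqr_ge0.
rewrite lte_add_pinfty//.
  rewrite integral_cst// mul1e; rewrite [X in (X < _)%E](_ : _ = mu `[a, b])//.
  by rewrite lebesgue_measure_itv/=; case: ifP => // _; rewrite -EFinB ltry.
apply: le_lt_trans f2; apply: ae_le_lower_integral.
- by move=> t _; rewrite lee_fin sqr_ge0.
- by move=> t _; rewrite lee_fin sqr_ge0.
- by apply: filterS fg => t h Dt; rewrite h.
Qed.

Lemma ae_neq (a : R) : {ae mu, forall t, t <> a}.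
Proof.
exists [set a : measurableTypeR R]; split.
- exact: measurable_set1.
- exact: lebesgue_measure_set1.
- by move=> t /= /contrapT.
Qed.

(** Local square integrability on the open half-line says nothing near [0]; the
    values on the first period are those on the second one, except at [0]. *)
Lemma periodic_L1 (V : normedModType R[i]) (tau : R) (f : R -> V) : 0 < tau ->
  L2loc_pos f -> tau_periodic_pos tau f ->
  strongly_measurable `[0, tau] f /\
  (\int[mu]_(t in `[0%R, tau]) (rnorm (f t))%:E < +oo)%E.
Proof.
move=> tau0 fL2 pf.
have f2 : L2 tau (tau + tau) f by apply: fL2 => //; rewrite lerDl ltW.
have itvE : translate tau @^-1` `[tau, tau + tau] = `[0, tau]%classic.
  by apply/seteqP; split => t /=; rewrite !in_itv/= /translate lerD2r lerDr.
have ff : {ae mu, forall t, `[0, tau]%classic t -> f (t + tau) = f t}.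
  apply: filterS (ae_neq 0) => t /eqP t0 /=; rewrite in_itv/= => /andP[t0' _].
  by apply: pf; rewrite lt_neqAle eq_sym t0.
split; first by apply: strongly_measurable_ae ff _; rewrite -itvE;
  apply: strongly_measurable_translate; case: f2.
apply: le_lt_trans (L2_L1 f2).
apply: le_trans (integral_rnorm_translate tau _ f2.1); last exact: measurable_itv.
rewrite itvE; apply: ae_le_lower_integral.
- by move=> t _; rewrite lee_fin rnorm_ge0.
- by move=> t _; rewrite lee_fin rnorm_ge0.
- by apply: filterS ff => t h Dt; rewrite h.
Qed.

End translation.

(** * Operator-valued functions acting on vector-valued functions *)

Section operator_functions.
Variable R : realType.
Local Notation mu := (@lebesgue_measure R).

(** Approximate the operator and the vector simultaneously by simple functions:
    [b v - B f = (b - B) v + B (v - f)], where the operator norm of [b - B] is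
    small, [v] stays bounded, and [B] is bounded. *)
Lemma strongly_measurable_Linfty_op (V W : normedModType R[i])
    (B : R -> bounded_op V W) (D : set R) (f : R -> V) :
  Linfty_op B -> strongly_measurable D f ->
  strongly_measurable D (fun t => B t (f t)).
Proof.
move=> [[b sb bB] [M BM]] [s ss sf]; exists (fun n t => b n t (s n t)).
  by move=> n; exact: (simple_comp (fun z : bounded_op V W * V => z.1 z.2) (simple_pair (sb n) (ss n))).
apply: filterS3 bB BM sf => t bBt BMt sft Dt.
have /cvg_rnormP d0 := sft Dt.
apply/cvg_rnormP/cvgrPdist_lt => e e0.
have e1 : 0 < e / 4 / (rnorm (f t) + 1).
  by rewrite !divr_gt0//; have := rnorm_ge0 (f t); lra.
have e2 : 0 < Num.min 1 (e / 4 / (`|M| + 1)).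
  by rewrite lt_min ltr01/= !divr_gt0//; have := normr_ge0 M; lra.
have {}d0 : \forall n \near \oo, rnorm (s n t - f t) < Num.min 1 (e / 4 / (`|M| + 1)).
  move/cvgrPdist_lt : d0 => /(_ _ e2); apply: filterS => n.
  by rewrite sub0r normrN ger0_norm ?rnorm_ge0.
apply: filterS2 (bBt _ e1) d0 => n h1; rewrite lt_min => /andP[h2 h3].
rewrite sub0r normrN ger0_norm ?rnorm_ge0//.
apply: (le_lt_trans (rnorm_dist_triangle _ (B t (s n t)) _)).
have h4 : rnorm (s n t) <= rnorm (f t) + 1.
  by have := rnormD (s n t - f t) (f t); rewrite subrK; lra.
have h5 : rnorm (b n t (s n t) - B t (s n t)) <= e / 4.
  apply: (le_trans (h1 _)); rewrite mulrAC ler_pdivrMr ?ler_wpM2l//; first by lra.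
  by have := rnorm_ge0 (f t); lra.
have h6 : rnorm (B t (s n t) - B t (f t)) <= e / 4.
  rewrite -linearB; apply: (le_trans (BMt _)).
  apply: (@le_trans _ _ ((`|M| + 1) * rnorm (s n t - f t))).
    by rewrite ler_wpM2r ?rnorm_ge0//; have := ler_norm M; lra.
  by rewrite mulrC -ler_pdivlMr ?ltW//; have := normr_ge0 M; lra.
by lra.
Qed.

Lemma Linfty_op_bound (V W : normedModType R[i]) (B : R -> bounded_op V W) :
  Linfty_op B -> exists2 M, 0 <= M &
    {ae mu, forall t, forall v, rnorm (B t v) <= M * rnorm v}.
Proof.
move=> [_ [M BM]]; exists `|M| => //; apply: filterS BM => t h v.
by apply: (le_trans (h v)); rewrite ler_wpM2r ?rnorm_ge0// ler_norm.
Qed.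

(** A strongly continuous family is in general not a limit of simple functions
    in the operator norm.  Instead the parameter [s] is approximated by simple
    functions [r n] with values in [[0, b]], and
    [T (r n s) (z n s) - T s (f s)] splits into
    [T (r n s) (z n s - f s)], controlled by the uniform bound, and
    [T (r n s) (f s) - T s (f s)], controlled by strong continuity. *)
Lemma strongly_measurable_strongly_continuous (V W : normedModType R[i])
    (b K : R) (T : R -> V -> W) (f : R -> V) :
  (forall s, linear (T s)) ->
  (forall s x, 0 <= s <= b -> rnorm (T s x) <= K * rnorm x) ->
  (forall x (r : nat -> R) s, (forall n, 0 <= r n <= b) -> 0 <= s <= b ->
     r n @[n --> \oo] --> s -> T (r n) x @[n --> \oo] --> T s x) ->
  strongly_measurable `[0, b] f ->
  strongly_measurable `[0, b] (fun s => T s (f s)).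
Proof.
move=> linT bT cT [z sz zf].
have mD : measurable (`[0, b]%classic : set (measurableTypeR R)).
  exact: measurable_itv.
have mid : measurable_fun (`[0, b]%classic : set (measurableTypeR R))
    (fun t : measurableTypeR R => t%:E).
  by apply/measurable_EFinP; exact: measurable_id.
(* Simple functions approximating the identity from below, hence with values
   in the interval on which [T] is bounded. *)
pose r n : {nnsfun (measurableTypeR R) >-> R} := nnsfun_approx mD mid n.
have r_bound n t : 0 <= t <= b -> 0 <= r n t <= b.
  move=> tb; rewrite fun_ge0/=; case/andP: (tb) => t0 ; apply: le_trans.
  rewrite -lee_fin /r nnsfun_approxE; apply: le_approx.
    by move=> x /=; rewrite in_itv/= lee_fin => /andP[].
  by rewrite /= in_itv.
have r_cvg t : 0 <= t <= b -> r n t @[n --> \oo] --> t.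
  move=> tb; rewrite /r; under eq_cvg do rewrite nnsfun_approxE.
  apply: (@cvg_approx _ _ _ `[0, b]%classic (fun t : measurableTypeR R => t%:E) t).
  - by move=> x /=; rewrite in_itv/= lee_fin => /andP[].
  - by rewrite /= in_itv.
  - exact: ltry.
have sr n : simple_function (r n : R -> R).
  split; first exact: (@fimfunP (measurableTypeR R) R (r n)).
  by move=> x; rewrite -[_ @^-1` _]setTI; exact: (measurable_funP (r n)).
exists (fun n t => T (r n t) (z n t)).
  by move=> n; exact: (simple_comp (fun y : R * V => T y.1 y.2) (simple_pair (sr n) (sz n))).
apply: filterS zf => t zft /=; rewrite in_itv/= => tb.
have /cvg_rnormP h1 : z n t @[n --> \oo] --> f t by apply: zft; rewrite /= in_itv.
have /cvg_rnormP h2 : T (r n t) (f t) @[n --> \oo] --> T t (f t).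
  by apply: cT => //; [move=> n; exact: r_bound|exact: r_cvg].
apply: (@cvg_rnorm_squeeze _ _ _ _ _ _ _
  (fun n => K * rnorm (z n t - f t) + rnorm (T (r n t) (f t) - T t (f t)))).
  apply: nearW => n; apply: (le_trans (rnorm_dist_triangle _ (T (r n t) (f t)) _)).
  rewrite lerD2r (addrC (T _ (z n t))) -scaleN1r -linT scaleN1r addrC.
  by apply: bT; exact: r_bound.
rewrite -[X in _ --> X]addr0; apply: cvgD => //.
by rewrite -(mulr0 K); apply: cvgM => //; exact: cvg_cst.
Qed.

End operator_functions.

(** * The monodromy operator of a stable evolution family *)

Section neumann.
Variables (R : realType) (X : completeNormedModType R[i]).
Variables (T : {linear X -> X}) (M q : R).
Hypotheses (M0 : 0 <= M) (q0 : 0 <= q) (q1 : q < 1).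
Hypothesis powT : forall n x, rnorm (iter n T x) <= M * q ^+ n * rnorm x.

Let qn_small (c e : R) : 0 < e -> exists n, c * q ^+ n < e.
Proof.
move=> e0; have h : c * q ^+ n @[n --> \oo] --> (0 : R).
  by rewrite -(mulr0 c); apply: cvgM; [exact: cvg_cst|apply: cvg_expr; rewrite ger0_norm].
move/cvgrPdist_lt : h => /(_ _ e0) [n _ /(_ n (leqnn n))] /=.
by rewrite sub0r normrN => h; exists n; apply: le_lt_trans h; exact: ler_norm.
Qed.

(** A fixed point of [T] is a fixed point of all its powers, which tend to
    zero. *)
Lemma neumann_injective x : x - T x = 0 -> x = 0.
Proof.
move=> /subr0_eq xT; apply: rnorm_eq0; apply/le_anti; rewrite rnorm_ge0 andbT.
apply/ler_addgt0Pr => e e0; rewrite add0r; have [n hn] := qn_small (M * rnorm x) e0.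
have xn : iter n T x = x by elim: n {hn} => //= n ->.
apply: ltW; apply: le_lt_trans hn; rewrite -{1}xn mulrAC; exact: powT.
Qed.

(** The solution is the Neumann series; the geometric decay of the powers makes
    it converge and bounds its sum. *)
Lemma neumann_surjective y :
  exists2 x, x - T x = y & rnorm x <= M / (1 - q) * rnorm y.
Proof.
pose p n := \sum_(k < n) iter k T y.
have pE n j : rnorm (p (n + j)%N - p n) <=
    M * rnorm y * ((q ^+ n - q ^+ (n + j)) / (1 - q)).
  elim: j => [|j IH]; first by rewrite addn0 !subrr mul0r mulr0 rnorm0.
  rewrite addnS {1}/p big_ord_recr/= addrAC; apply: (le_trans (rnormD _ _)).
  apply: (le_trans (lerD IH (powT _ _))); rewrite exprS le_eqVlt; apply/orP; left.
  by apply/eqP; field; rewrite subr_eq0; apply/eqP => h; move: q1; rewrite -h ltxx.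
have pB n j : rnorm (p (n + j)%N - p n) <= M / (1 - q) * rnorm y * q ^+ n.
  apply: (le_trans (pE n j)).
  rewrite [leRHS](_ : _ = M * rnorm y * (q ^+ n / (1 - q))); last by ring.
  apply: ler_wpM2l; first by rewrite mulr_ge0 ?rnorm_ge0.
  apply: ler_wpM2r; first by rewrite invr_ge0 subr_ge0 ltW.
  by rewrite gerBl exprn_ge0.
have [x px] : exists x : X, p n @[n --> \oo] --> x.
  apply: (@rnorm_cauchy_cvg _ X p) => e e0; have e2 : 0 < e / 2 by lra.
  have [N hN] := qn_small (M / (1 - q) * rnorm y) e2.
  exists N => n m /subnKC <- /subnKC <-.
  have h1 := pB N (n - N)%N; have h2 := pB N (m - N)%N.
  apply: (le_lt_trans (rnorm_dist_triangle _ (p N) _)).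
  rewrite (splitr e) (rnorm_distC (p N)).
  by apply: ltrD; apply: le_lt_trans hN.
have bT z : rnorm (T z) <= M * q * rnorm z by exact: (powT 1).
exists x.
  have Tpx : p n - T (p n) @[n --> \oo] --> x - T x.
    by apply: cvgB => //; apply: (linear_bound_cvg _ bT) => //; exact: linearP.
  have pTy : p n - T (p n) @[n --> \oo] --> y.
    apply: (@cvg_rnorm_squeeze _ _ _ _ _ _ _ (fun n => M * rnorm y * q ^+ n)).
      apply: nearW => n; rewrite (_ : p n - T (p n) = y - iter n T y).
        by rewrite addrAC subrr add0r rnormN mulrAC; exact: powT.
      rewrite /p linear_sum/=; elim: n => [|n IH].
        by rewrite !big_ord0 !subrr.
      by rewrite !big_ord_recr/= opprD addrACA IH addrA subrK.
    rewrite -(mulr0 (M * rnorm y)); apply: cvgM; first exact: cvg_cst.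
    by apply: cvg_expr; rewrite ger0_norm.
  exact: (cvg_unique _ Tpx pTy).
apply/ler_addgt0Pr => e e0.
move/cvg_rnormP/cvgrPdist_lt : px => /(_ _ e0) [n _ /(_ n (leqnn n))] /=.
rewrite sub0r normrN ger0_norm ?rnorm_ge0// rnorm_distC => h.
have := pB 0 n; rewrite /p add0n big_ord0 subr0 expr0 mulr1 -/(p n) => h'.
by have := rnormD (x - p n) (p n); rewrite subrK; lra.
Qed.

(** The set-theoretic inverse is linear because solutions are unique. *)
Lemma neumann_inverse :
  [/\ forall y, inverse_map (fun x => x - T x) y - T (inverse_map (fun x => x - T x) y) = y,
      linear (inverse_map (fun x => x - T x))
    & forall y, rnorm (inverse_map (fun x => x - T x) y) <= M / (1 - q) * rnorm y].
Proof.
set S := inverse_map _.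
have SK y : S y - T (S y) = y.
  rewrite /S /inverse_map; case: xgetP => // h.
  by have [x xy _] := neumann_surjective y; case: (h x).
have Suniq x y : x - T x = y -> S y = x.
  move=> xy; apply/subr0_eq/neumann_injective.
  by rewrite linearB opprD opprK addrACA SK -xy addrACA subrr addNr addr0.
split => //.
  move=> a x y; apply: Suniq.
  by rewrite linearP opprD addrACA -scalerBr !SK.
by move=> y; have [x xy xb] := neumann_surjective y; rewrite (Suniq _ _ xy).
Qed.

End neumann.

Section evolution.
Variables (R : realType) (tau : R) (X : completeNormedModType R[i]).
Variable U : R -> R -> bounded_op X X.
Hypothesis tau0 : 0 < tau.
Hypothesis evU : evolution_family tau U.
Hypothesis stable : exponentially_stable U.

Lemma evolution_shift n t s x : s <= t ->
  U (t + n%:R * tau) (s + n%:R * tau) x = U t s x.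
Proof.
move=> st; have [_ _ _ perU] := evU.
elim: n => [|n IH]; first by rewrite mul0r !addr0.
by rewrite -natr1 mulrDl mul1r !addrA perU ?lerD2r.
Qed.

(** By periodicity, powers of the monodromy operator are evolution over several
    periods, so stability bounds them geometrically. *)
Lemma monodromy_iter n x : iter n (U tau 0) x = U (n%:R * tau) 0 x.
Proof.
have [U1 Ucomp _ _] := evU; elim: n => [|n IH]; first by rewrite mul0r U1.
rewrite iterS IH -(evolution_shift n) ?ltW// add0r.
rewrite Ucomp; first by rewrite -natr1 mulrDl mul1r addrC.
- by rewrite mulr_ge0 ?ler0n// ltW.
- by rewrite lerDr ltW.
Qed.

Lemma evolution_bounded : exists2 M, 0 <= M &
  forall t s x, s <= t -> rnorm (U t s x) <= M * rnorm x.
Proof.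
have [M [w [M0 w0 h]]] := stable; exists M; first exact: ltW.
move=> t s x st; apply: (le_trans (h _ _ _ st)); rewrite ler_wpM2r ?rnorm_ge0//.
by rewrite ler_piMr ?(ltW M0)// -[leRHS]expR0 ler_expR mulNr oppr_le0 mulr_ge0 ?subr_ge0 ?(ltW w0).
Qed.

Lemma monodromy_resolvent : exists2 K,
  forall y, rnorm (inverse_map (fun x => x - U tau 0 x) y) <= K * rnorm y &
  linear (inverse_map (fun x => x - U tau 0 x)) /\
  forall y, inverse_map (fun x => x - U tau 0 x) y
    - U tau 0 (inverse_map (fun x => x - U tau 0 x) y) = y.
Proof.
have [M [w [M0 w0 h]]] := stable.
have powT n x : rnorm (iter n (U tau 0) x) <= M * expR (- w * tau) ^+ n * rnorm x.
  rewrite monodromy_iter -expRM_natl; apply: le_trans (h _ _ _ _) _.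
    by rewrite mulr_ge0 ?ler0n// ltW.
  by rewrite subr0 mulrCA.
have q1 : expR (- w * tau) < 1.
  by rewrite -[ltRHS]expR0 ltr_expR mulNr oppr_lt0 mulr_gt0.
have [SK linS bS] := neumann_inverse (ltW M0) (expR_ge0 _) q1 powT.
by exists (M / (1 - expR (- w * tau))).
Qed.

End evolution.

(** * Variation of constants integrals *)

Section bochner_L1_theory.
Variable R : realType.
Local Notation mu := (@lebesgue_measure R).
Implicit Types V W : normedModType R[i].

Definition bochner_L1 V (a b : R) (f : R -> V) :=
  strongly_measurable `[a, b] f /\
  (\int[mu]_(t in `[a, b]) (rnorm (f t))%:E < +oo)%E.

Lemma bochner_L1_ae V (a b : R) (f g : R -> V) :
  {ae mu, forall t, `[a, b]%classic t -> f t = g t} ->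
  bochner_L1 a b f -> bochner_L1 a b g.
Proof.
move=> fg [mf fint]; split; first exact: strongly_measurable_ae mf.
apply: le_lt_trans fint; apply: ae_le_lower_integral.
- by move=> t _; rewrite lee_fin rnorm_ge0.
- by move=> t _; rewrite lee_fin rnorm_ge0.
- by apply: filterS fg => t h Dt; rewrite h.
Qed.

Lemma bochner_L1_sub V (a b c : R) (f : R -> V) : c <= b ->
  bochner_L1 a b f -> bochner_L1 a c f.
Proof.
move=> cb [[s ss sf] fint].
have sub t : `[a, c]%classic t -> `[a, b]%classic t.
  by rewrite /= !in_itv/= => /andP[-> /le_trans]; apply.
split; first by exists s => //; apply: filterS sf => t h /sub.
apply: le_lt_trans fint; rewrite integral_mkcond [leRHS]integral_mkcond.
apply: ae_le_lower_integral.
- by move=> t _; rewrite patchE; case: ifP => // _; rewrite lee_fin rnorm_ge0.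
- by move=> t _; rewrite patchE; case: ifP => // _; rewrite lee_fin rnorm_ge0.
- apply: aeW => t _; rewrite !patchE; case: ifPn => [/set_mem/sub tb|_].
    by rewrite mem_set.
  by case: ifP => // _; rewrite lee_fin rnorm_ge0.
Qed.

(** The norm of [f] may be Borel only off a null set, so the factor [K] is
    pulled out of a lower integral; this needs [f] strongly measurable. *)
Lemma bochner_L1_dominated V W (a b K : R) (f : R -> V) (g : R -> W) : 0 <= K ->
  strongly_measurable `[a, b] g ->
  {ae mu, forall t, `[a, b]%classic t -> rnorm (g t) <= K * rnorm (f t)} ->
  bochner_L1 a b f -> bochner_L1 a b g.
Proof.
move=> K0 mg gf [mf fint]; split => //.
have mab : measurable (`[a, b]%classic : set (measurableTypeR R)).
  exact: measurable_itv.
have h := @integral_rnorm_le_lincomb _ _ _ _ _ f f g K 0 mab mf mf K0 (lexx 0).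
apply: (le_lt_trans (h _)).
  by apply: filterS gf => t h' Dt; rewrite mul0r addr0; exact: h'.
rewrite mul0e adde0; have := ge0_integral_rnorm `[a, b]%classic f.
move: fint; case: (\int[mu]_(t in _) _)%E => [r _ _| |]//=.
by rewrite -EFinM ltry.
Qed.

Lemma bochner_L1D V (a b : R) (f g : R -> V) :
  bochner_L1 a b f -> bochner_L1 a b g -> bochner_L1 a b (f \+ g).
Proof.
move=> [mf fint] [mg gint]; split; first exact: strongly_measurableD.
have mab : measurable (`[a, b]%classic : set (measurableTypeR R)).
  exact: measurable_itv.
have h := @integral_rnorm_le_lincomb _ _ _ _ _ f g (f \+ g) 1 1 mab mf mg ler01 ler01.
apply: (le_lt_trans (h _)); last by rewrite !mul1e lte_add_pinfty.
by apply: aeW => t _; rewrite !mul1r; exact: rnormD.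
Qed.

Lemma bochner_L1_Linfty_op V W (B : R -> bounded_op V W) (a b : R) (f : R -> V) :
  Linfty_op B -> bochner_L1 a b f -> bochner_L1 a b (fun t => B t (f t)).
Proof.
move=> hB fL1; have [M M0 BM] := Linfty_op_bound hB.
apply: (bochner_L1_dominated M0 _ _ fL1).
  by apply: strongly_measurable_Linfty_op => //; case: fL1.
by apply: filterS BM => t h _; exact: h.
Qed.

(** A point is a null set, so the function may be replaced by zero. *)
Lemma is_bochner_integral_point V (a : R) (f : R -> V) :
  is_bochner_integral a a f 0.
Proof.
apply: (@is_bochner_integral_ae _ _ _ _ (fun=> 0)).
  apply: filterS (ae_neq a) => t ta /=; rewrite in_itv/= => h.
  by exfalso; apply: ta; apply/le_anti; rewrite andbC.
have s0 : simple_function ((fun=> 0) : R -> V).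
  exact: (simple_comp (fun=> 0 : V) (simple_indicator (@measurable0 _ (measurableTypeR R)))).
split; first exact: strongly_measurable_simple.
have i0 : (\int[mu]_(t in `[a, a]) (rnorm (0 : V))%:E = 0)%E.
  by rewrite rnorm0 integral0.
exists (fun _ _ => 0); split => //.
  by rewrite subr0 i0; exact: cvg_cst.
rewrite (_ : simple_integral _ _ _ = 0); first exact: cvg_cst.
apply: rnorm_eq0; apply/le_anti; rewrite rnorm_ge0 andbT -lee_fin.
by apply: (le_trans (rnorm_simple_integral_le a a s0)); rewrite i0.
Qed.

End bochner_L1_theory.

Section evolution_integrals.
Variables (R : realType) (tau : R) (X : completeNormedModType R[i]).
Variable U : R -> R -> bounded_op X X.
Hypothesis tau0 : 0 < tau.
Hypothesis evU : evolution_family tau U.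
Hypothesis stable : exponentially_stable U.

(** Strong continuity of [s |-> U t s] is the continuity of the evolution family
    on the half plane [s <= t], restricted to a line. *)
Lemma bochner_L1_evolution (t : R) (f : R -> X) :
  bochner_L1 0 t f -> bochner_L1 0 t (fun s => U t s (f s)).
Proof.
move=> fL1; have [M M0 UM] := evolution_bounded stable.
have [_ _ Ucont _] := evU.
have Ub s x : 0 <= s <= t -> rnorm (U t s x) <= M * rnorm x by move=> /andP[_ /UM].
apply: (bochner_L1_dominated M0 _ _ fL1).
  apply: (strongly_measurable_strongly_continuous _ Ub) => //.
  - by move=> s; exact: linearP.
  - move=> x r s rt /andP[_ st] rs.
    have /subspace_continuousP/(_ (t, s) st) h := Ucont x.
    have rw : (t, r n) @[n --> \oo] -->
        within [set p : R * R | p.2 <= p.1] (nbhs (t, s)).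
      move=> A hA.
      have cst_t : t @[_ --> \oo] --> t by exact: cvg_cst.
      have ts : (t, r n) @[n --> \oo] --> (nbhs t, nbhs s) by exact: cvg_pair.
      have [N _ hN] := ts _ hA; exists N => // n Nn; apply: hN => //=.
      by have /andP[] := rt n.
    exact: (cvg_comp _ _ rw h).
  - by case: fL1.
by apply: aeW => s /=; rewrite in_itv/= => /Ub.
Qed.

Lemma evolution_integral (t : R) (f : R -> X) : t <= tau -> bochner_L1 0 tau f ->
  is_bochner_integral 0 t (fun s => U t s (f s))
    (bochner_integral 0 t (fun s => U t s (f s))).
Proof.
move=> ttau /(bochner_L1_sub ttau)/bochner_L1_evolution [mf fint].
by have [v hv] := bochner_integrableP mf fint; rewrite (bochner_integralE hv).
Qed.

(** The Green kernel is a bounded operator depending on [t] only, applied to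
    [U tau s], and bounded operators commute with the integral. *)
Lemma green_integral (t : R) (f : R -> X) : 0 <= t -> bochner_L1 0 tau f ->
  is_bochner_integral 0 tau (fun s => green tau U t s (f s))
    (U t 0 (inverse_map (fun x => x - U tau 0 x)
      (bochner_integral 0 tau (fun s => U tau s (f s))))).
Proof.
move=> t0 fL1; have [K SK [linS _]] := monodromy_resolvent tau0 evU stable.
have [M M0 UM] := evolution_bounded stable.
apply: (@is_bochner_integral_linear _ _ _ _ _
  (fun y => U t 0 (inverse_map (fun x => x - U tau 0 x) y)) (M * K)).
- by move=> a x y; rewrite linS linearP.
- by move=> x; apply: (le_trans (UM _ _ _ t0)); rewrite -mulrA ler_wpM2l.
- exact: evolution_integral.
Qed.

End evolution_integrals.

Section periodic_extension_theory.
Variables (R : realType) (tau : R) (T : Type) (f : R -> T).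
Hypothesis tau0 : 0 < tau.

Lemma periodic_extension_periodic : tau_periodic tau (periodic_extension tau f).
Proof.
move=> t; rewrite /periodic_extension mulrDl divff ?gt_eqF//.
rewrite floorDrz ?rpred1// floor1 intrD mulrDr mulr1 opprD addrACA subrr addr0//.
Qed.

Lemma periodic_extension_id t : 0 <= t < tau -> periodic_extension tau f t = f t.
Proof.
move=> /andP[t0 tt]; rewrite /periodic_extension (_ : Num.floor _ = 0).
  by rewrite mulr0 subr0.
by apply: floor_def; rewrite add0r divr_ge0 ?(ltW tau0)// ltr_pdivrMr// mul1r.
Qed.

Lemma periodic_extension_end : periodic_extension tau f tau = f 0.
Proof.
have := periodic_extension_periodic 0; rewrite add0r => ->.
by rewrite periodic_extension_id// lexx.
Qed.

End periodic_extension_theory.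

(** * The periodic state and the regulator equations *)

Section periodic_state.
Variables (R : realType) (tau : R) (X : completeNormedModType R[i]).
Variable U : R -> R -> bounded_op X X.
Hypothesis tau0 : 0 < tau.
Hypothesis evU : evolution_family tau U.
Hypothesis stable : exponentially_stable U.
Local Notation mu := (@lebesgue_measure R).

(** The state part of the operators [P] and [P_d]: the response to the forcing
    term [f] that starts from the periodic initial state. *)
Definition periodic_state (f : R -> X) (t : R) : X :=
  bochner_integral 0 tau (fun s => green tau U t s (f s))
  + bochner_integral 0 t (fun s => U t s (f s)).

(** At time [0] the Green term is the solution of [x - U tau 0 x = J], where [J]
    is the response over one period from rest. *)
Lemma periodic_state0 (f : R -> X) : bochner_L1 0 tau f ->
  periodic_state f 0 = inverse_map (fun x => x - U tau 0 x)
    (bochner_integral 0 tau (fun s => U tau s (f s))).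
Proof.
move=> fL1; have [U1 _ _ _] := evU.
rewrite /periodic_state (bochner_integralE (green_integral tau0 evU stable _ fL1))// U1.
by rewrite (bochner_integralE (is_bochner_integral_point _ _)) addr0.
Qed.

Lemma periodic_state_mild (f : R -> X) (t : R) : 0 <= t -> bochner_L1 0 tau f ->
  periodic_state f t =
  U t 0 (periodic_state f 0) + bochner_integral 0 t (fun s => U t s (f s)).
Proof.
by move=> t0 fL1; rewrite periodic_state0// /periodic_state
  (bochner_integralE (green_integral tau0 evU stable t0 fL1)).
Qed.

(** The defining equation of the initial state closes the orbit after one
    period. *)
Lemma periodic_state_end (f : R -> X) : bochner_L1 0 tau f ->
  periodic_state f tau = periodic_state f 0.
Proof.
move=> fL1; rewrite (periodic_state_mild (ltW tau0) fL1) periodic_state0//.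
have [_ _ [_ SK]] := monodromy_resolvent tau0 evU stable.
set J := bochner_integral _ _ _.
by rewrite -[X in _ + X = _]SK addrC subrK.
Qed.

Lemma periodic_stateD (f g : R -> X) (t : R) : 0 <= t <= tau ->
  bochner_L1 0 tau f -> bochner_L1 0 tau g ->
  periodic_state (f \+ g) t = periodic_state f t + periodic_state g t.
Proof.
move=> /andP[t0 ttau] fL1 gL1; rewrite /periodic_state.
have If := evolution_integral evU stable ttau fL1.
have Ig := evolution_integral evU stable ttau gL1.
have Gf := green_integral tau0 evU stable t0 fL1.
have Gg := green_integral tau0 evU stable t0 gL1.
have [_ _ [linS _]] := monodromy_resolvent tau0 evU stable.
rewrite (_ : (fun s => green tau U t s _) =
    (fun s => green tau U t s (f s)) \+ (fun s => green tau U t s (g s))); last first.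
  apply/funext => s.
  have := linS 1 (U tau s (f s)) (U tau s (g s)); rewrite !scale1r => invD.
  by rewrite /green /= linearD invD linearD.
rewrite (_ : (fun s => U t s _) =
    (fun s => U t s (f s)) \+ (fun s => U t s (g s))); last first.
  by apply/funext => s; rewrite /= linearD.
rewrite (bochner_integralE (is_bochner_integralD Gf Gg)).
rewrite (bochner_integralE (is_bochner_integralD If Ig)).
by rewrite (bochner_integralE Gf) (bochner_integralE Gg) addrACA.
Qed.

Lemma periodic_state_ae (f g : R -> X) (t : R) : 0 <= t <= tau ->
  {ae mu, forall s, `[0, tau]%classic s -> f s = g s} ->
  bochner_L1 0 tau f -> periodic_state f t = periodic_state g t.
Proof.
move=> /andP[t0 ttau] fg fL1; rewrite /periodic_state.
have If := evolution_integral evU stable ttau fL1.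
have Gf := green_integral tau0 evU stable t0 fL1.
rewrite (bochner_integralE Gf); congr (_ + _); apply/esym/bochner_integralE.
  by apply: is_bochner_integral_ae Gf; apply: filterS fg => s h Ds; rewrite h.
apply: is_bochner_integral_ae If; apply: filterS fg => s h /=.
rewrite in_itv/= => /andP[s0 st]; rewrite h//= in_itv/= s0/=.
exact: le_trans st ttau.
Qed.

End periodic_state.

Theorem theorem3p6 (R : realType) (tau : R) (tau_gt0 : 0 < tau)
    (X U0 Ud0 Y0 : completeNormedModType R[i])
    (hU0 : hilbert_space U0) (hUd0 : hilbert_space Ud0)
    (hY0 : hilbert_space Y0)
    (U_A : R -> R -> bounded_op X X)
    (B : R -> bounded_op U0 X) (Bd : R -> bounded_op Ud0 X)
    (C : R -> bounded_op X Y0) (D : R -> bounded_op U0 Y0)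
    (hB : Linfty_op B) (hBd : Linfty_op Bd)
    (hC : Linfty_op C) (hD : Linfty_op D)
    (pB : tau_periodic tau B) (pBd : tau_periodic tau Bd)
    (pC : tau_periodic tau C) (pD : tau_periodic tau D)
    (hU_A : evolution_family tau U_A)
    (stable : exponentially_stable U_A)
    (y_ref : R -> Y0) (w_dist : R -> Ud0)
    (hy : L2loc_pos y_ref) (py : tau_periodic_pos tau y_ref)
    (hw : L2loc_pos w_dist) (pw : tau_periodic_pos tau w_dist)
    (u_reg : R -> U0) (hu_reg : L2 0 tau u_reg)
    (output_eq : {ae @lebesgue_measure R, forall t, `[0, tau]%classic t ->
       input_map tau U_A B C D u_reg t
       = y_ref t - disturbance_map tau U_A Bd C w_dist t}) :
  let u := periodic_extension tau u_reg in
  let S : R -> 'M[R[i]]_1 := fun=> 0 in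
  let E := fun t => op_of_vec (w_dist t) in
  let F := fun t => op_of_vec (- y_ref t) in
  let v0 : 'cV[R[i]]_1 := const_mx 1 in
  exists (Pi : R -> bounded_op 'cV[R[i]]_1 X)
         (Gamma : R -> bounded_op 'cV[R[i]]_1 U0)
         (v : R -> 'cV[R[i]]_1),
    [/\ periodic_mild_solution tau U_A B Bd C D S E F Pi Gamma,
        exosystem_state S v0 v,
        forall t, w_dist t = E t (v t),
        forall t, y_ref t = - F t (v t)
      & forall t, u t = Gamma t (v t)].
Proof.
move=> u S E F v0.
have const_derivative (V : normedModType R[i]) (c : V) t :
    has_derivative (fun=> c) t 0.
  rewrite /has_derivative (_ : (fun h : R => _) = cst 0); last first.
    by apply/funext => h; rewrite subrr scaler0.
  exact: cvg_cst.
(* The periodic extension takes at [tau] the value at [0], hence the two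
   controls may differ there. *)
have u_ae : {ae @lebesgue_measure R, forall t, `[0, tau]%classic t -> u_reg t = u t}.
  apply: filterS (ae_neq tau) => t ttau /=; rewrite in_itv/= => /andP[t0 t1].
  by rewrite /u periodic_extension_id// t0 lt_neqAle t1 andbT; apply/eqP.
have uregL1 : bochner_L1 0 tau u_reg by split; [case: hu_reg|exact: L2_L1].
have uL1 : bochner_L1 0 tau u := bochner_L1_ae u_ae uregL1.
have wL1 : bochner_L1 0 tau w_dist := periodic_L1 tau_gt0 hw pw.
have Bu_ae : {ae @lebesgue_measure R, forall t, `[0, tau]%classic t ->
    B t (u_reg t) = B t (u t)}.
  by apply: filterS (u_ae) => t h Dt; rewrite h.
have BuregL1 := bochner_L1_Linfty_op hB uregL1.
have BuL1 := bochner_L1_Linfty_op hB uL1.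
have BdwL1 := bochner_L1_Linfty_op hBd wL1.
pose f := (fun s => B s (u s)) \+ (fun s => Bd s (w_dist s)).
have fL1 : bochner_L1 0 tau f := bochner_L1D BuL1 BdwL1.
pose x := periodic_state tau U_A f.
pose Pi t := op_of_vec (periodic_extension tau x t).
(* On the closed period the extension of [x] is [x], because the orbit
   closes. *)
have stateE t : 0 <= t <= tau -> periodic_extension tau x t = x t.
  move=> /andP[t0]; rewrite le_eqVlt => /orP[/eqP ->|t1].
    by rewrite periodic_extension_end// /x (periodic_state_end tau_gt0 hU_A stable).
  by rewrite periodic_extension_id// t0.
exists Pi, (fun t => op_of_vec (u t)), (fun=> v0); split; last 1 first.
- by move=> t; rewrite /= /vec_map mxE scale1r.
- exists (fun _ _ => 1%:M).
    split=> // t s; rewrite mul0mx; exact: const_derivative.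
  split.
  + by move=> t; rewrite /Pi periodic_extension_periodic.
  + by move=> t; rewrite /u periodic_extension_periodic.
  + move=> t z t0 t1 g.
    have gE : g = (fun y : X => z 0 0 *: y) \o (fun s => U_A t s (f s)).
      apply/funext => s; rewrite /g /= /vec_map mul1mx !linearZ -scalerDr linearZ.
      by rewrite /f.
    have hI : is_bochner_integral 0 t g
        (z 0 0 *: bochner_integral 0 t (fun s => U_A t s (f s))).
      rewrite gE; apply: (@is_bochner_integral_linear _ _ _ _ _
        (fun y : X => z 0 0 *: y) (complex.Re `|z 0 0|)).
      * by move=> a y y'; rewrite scalerDr !scalerA mulrC.
      * by move=> y; rewrite rnormZ.
      * exact: (evolution_integral hU_A stable).
    split; first by exists (z 0 0 *: bochner_integral 0 t (fun s => U_A t s (f s))).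
    rewrite (bochner_integralE hI) mul1mx /Pi /= /vec_map !stateE ?t0 ?lexx ?(ltW tau_gt0)//.
    rewrite linearZ -scalerDr; congr (_ *: _).
    exact: (periodic_state_mild tau_gt0 hU_A stable).
  (* The output equation: by additivity the state is the sum of the responses
     to the control and to the disturbance. *)
  + apply: filterS2 u_ae output_eq => t uE /[swap] t01 /(_ t01).
    have t01' : 0 <= t <= tau by move: t01; rewrite /= in_itv.
    rewrite /input_map /disturbance_map -!linearD => yE z.
    rewrite /Pi /= /vec_map stateE// !linearZ -!scalerDr.
    rewrite /x (periodic_stateD tau_gt0 hU_A stable t01' BuL1 BdwL1).
    rewrite -(periodic_state_ae tau_gt0 hU_A stable t01' Bu_ae BuregL1).
    by rewrite -(uE t01) (linearD (C t)) [X in X - _]addrAC yE subrK subrr scaler0.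
- by split => // t; rewrite mul0mx; exact: const_derivative.
- by move=> t; rewrite /= /vec_map mxE scale1r.
- by move=> t; rewrite /= /vec_map mxE scale1r opprK.
Qed.
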